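(* Let $f\colon[0,1]\to[0,1]$ be a continuous map. Then the following three quantities are equal (and they belong to $\mathbb N_0\cup\{\infty\}$): (a) the polynomial entropy $h_{\mathrm{pol}}(f)$; (b) the supremum of the orders of one-way horseshoes of $f$ and its iterates $f^n$, $n\ge 1$; (c) the supremum of the orders of one-way horseshoes of $f$ and its iterates $f^n$, $n\ge1$, consisting of closed intervals. In particular, if the polynomial entropy of $f$ is finite, then it is an integer.
   Context: The supremum of the empty set is taken to be $0$. One-way horseshoe: for a continuous map $g\colon[0,1]\to[0,1]$, a one-way horseshoe of order $\ell\ge1$ for $g$ is an indexed family $A_1,\dots,A_\ell$ of pairwise disjoint compact sets such that $A_\ell$ contains a non-recurrent point of $g$ and $g(A_i)\supseteq A_j$ for all $1\le i\le j\le\ell$. A point $x$ is recurrent for $g$ if for every $\varepsilon>0$ there is $n\ge1$ with $|g^n(x)-x|<\varepsilon$; otherwise it is non-recurrent. Polynomial entropy: $S$ is $(n,\varepsilon,f)$-separated if $\max_{0\le i\le n-1}|f^i(x)-f^i(y)|>\varepsilon$ for any distinct $x,y\in S$; $\mathrm{sep}(n,\varepsilon,f)$ is the maximal cardinality of an $(n,\varepsilon,f)$-separated set; $h_{\mathrm{pol}}(f)=\lim_{\varepsilon\to0}\limsup_{n\to\infty}\frac{\log\mathrm{sep}(n,\varepsilon,f)}{\log n}$. *)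

(* Defs.v *)
From mathcomp Require Import all_boot all_order all_algebra finmap.
From mathcomp Require Import all_classical all_reals all_analysis.
Import Order.TTheory GRing.Theory Num.Theory.
Import numFieldNormedType.Exports.

Set Implicit Arguments.
Unset Strict Implicit.
Unset Printing Implicit Defensive.

Local Open Scope classical_set_scope.
Local Open Scope ring_scope.

(** A self-map of [0,1] is given by a function [g : R -> R]; only its
    restriction to [0,1] matters. *)
Section OneWayHorseshoe.
Context {R : realType}.
Implicit Types (g : R -> R) (A : nat -> set R) (l : nat) (x y eps : R).

Definition unitI : set R := `[0, 1].

Definition recurrent g x : Prop :=
  forall eps, 0 < eps -> exists2 n, (0 < n)%N & `|iter n g x - x| < eps.

(** The family is indexed by 1, ..., l; the values of [A] at other indices are
    irrelevant. *)
Definition one_way_horseshoe g l A : Prop :=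
  [/\ (0 < l)%N,
      forall i, (1 <= i <= l)%N -> A i `<=` unitI /\ compact (A i),
      forall i j, (1 <= i <= l)%N -> (1 <= j <= l)%N -> i <> j ->
        A i `&` A j = set0,
      (exists2 x, A l x & ~ recurrent g x) &
      forall i j, (1 <= i)%N -> (i <= j)%N -> (j <= l)%N -> A j `<=` g @` A i].

Definition closed_interval (B : set R) : Prop :=
  exists a b : R, a <= b /\ B = `[a, b]%classic.

Definition horseshoe_orders g : set (\bar R) :=
  [set l%:R%:E | l in [set l | exists n A,
     (0 < n)%N /\ one_way_horseshoe (iter n g) l A]].

Definition interval_horseshoe_orders g : set (\bar R) :=
  [set l%:R%:E | l in [set l | exists n A,
     [/\ (0 < n)%N, one_way_horseshoe (iter n g) l A &
         forall i, (1 <= i <= l)%N -> closed_interval (A i)]]].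

(** The library has [ereal_sup set0 = -oo]; here the empty supremum is 0. *)
Definition esup_or0 (B : set (\bar R)) : \bar R :=
  if B == set0 then 0%E else ereal_sup B.

End OneWayHorseshoe.

Section PolynomialEntropy.
Context {R : realType}.
Implicit Types (g : R -> R) (n : nat) (x y eps : R).

Definition bowen_dist n g x y : R :=
  \big[Num.max/0]_(i < n) `|iter i g x - iter i g y|.

Definition bowen_separated n eps g (S : set R) : Prop :=
  forall x y, S x -> S y -> x <> y -> eps < bowen_dist n g x y.

(** The supremum is over finite separated subsets of [0,1]; it is [+oo] exactly
    when such sets have unbounded cardinality. *)
Definition sep n eps g : \bar R :=
  ereal_sup [set (#|` S|)%:R%:E | S in
    [set S : {fset R} | [set` S] `<=` unitI /\ bowen_separated n eps g [set` S]]].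

Definition hpol g : \bar R :=
  lim ((fun eps => limn_esup (fun n => lne (sep n eps g) / (ln n%:R)%:E)%E)
         @ 0^'+).

Definition nat_or_infty : set (\bar R) :=
  [set x | x = +oo%E \/ exists k : nat, x = k%:R%:E].

End PolynomialEntropy.

(* Main.v *)
(** Lower bound: if [A_1, ..., A_l] is a one-way horseshoe of [g = f^m] and [x] is
    a non-recurrent point of [A_l], then for all waiting times [d_1, ..., d_l < N]
    some point waits [d_i] steps in each [A_i] and then hits [x] exactly.  At the
    first index where the waiting times differ, the two orbits lie in two
    different [A_i], or one of them is at [x] while the other one has already
    left it; so these [N^l] points are separated by a distance independent of [N].

    Upper bound: suppose that the orders of interval one-way horseshoes of the
    iterates are at most [L].  Then no iterate is turbulent, and no period
    doubling cascade is deep, so that some iterate [g] has no point of period 2.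
    For such a [g], a point that moves up stays above its initial position
    forever, and symmetrically.  Say that a fixed point [a] is an (upward) gate
    at scale [e] if [g x > x] just to the right of [a] and orbits starting there
    climb to [a + e].  There are finitely many gates, an orbit leaves a
    neighbourhood of each gate at most once, and the gates left by one orbit form
    a one-way horseshoe: hence at most [L] exits.  Every orbit gets close to a
    fixed point and then stays [2e]-close to it until its next exit, so up to
    finitely many choices an orbit segment of length [n] is determined at scale
    [e] by its exit times, which leaves [O(n^L)] possibilities. *)

Require Import Defs.
From mathcomp Require Import all_boot all_order all_algebra finmap.
From mathcomp Require Import all_classical all_reals all_analysis.
From mathcomp Require Import ring lra zify.
Import Order.TTheory GRing.Theory Num.Theory.
Import numFieldNormedType.Exports.

Local Open Scope classical_set_scope.
Local Open Scope ring_scope.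

Set Implicit Arguments.
Unset Strict Implicit.
Unset Printing Implicit Defensive.

(** * Continuous maps of the line *)

Section ContinuousMaps.
Context {R : realType}.
Implicit Types (g h : R -> R) (a b c u v w x y z : R) (m n : nat).

Lemma ivt_up g a b v : continuous g -> a <= b -> g a <= v <= g b ->
  exists2 c, a <= c <= b & g c = v.
Proof.
move=> gc ab /andP[av vb]; have [|c cab gcv] := @IVT R g a b v ab (continuous_subspaceT gc).
  by rewrite ge_min av le_max vb orbT.
by exists c => //; move: cab; rewrite in_itv.
Qed.

Lemma ivt_down g a b v : continuous g -> a <= b -> g b <= v <= g a ->
  exists2 c, a <= c <= b & g c = v.
Proof.
move=> gc ab /andP[av vb]; have [|c cab gcv] := @IVT R g a b v ab (continuous_subspaceT gc).
  by rewrite ge_min av le_max vb !orbT.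
by exists c => //; move: cab; rewrite in_itv.
Qed.

Lemma cont_delta g x e : continuous g -> 0 < e ->
  exists2 d, 0 < d & forall y, x - d < y < x + d -> g x - e < g y < g x + e.
Proof.
move=> gc e0; have /cvgrPdist_lt/(_ _ e0) := gc x.
case/nbhs_ballP => d /= d0 H; exists d => // y yd.
have /= := H y; rewrite /ball /= !ltr_norml => K.
suff : - e < g x - g y < e by lra.
by apply: K; lra.
Qed.

Lemma continuous_iter g n : continuous g -> continuous (iter n g).
Proof.
move=> gc; elim: n => [x|n IH x]; first exact: cvg_id.
exact: (@continuous_comp _ _ _ (iter n g) g x (IH x) (gc _)).
Qed.

(** [z] is the supremum of the points up to which [h] stays positive; by continuity neither sign is
    possible there. *)
Lemma first_zero h w b : continuous h -> w < b -> 0 < h w -> h b <= 0 ->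
  exists z, [/\ w < z <= b, h z = 0 & forall x, w <= x < z -> 0 < h x].
Proof.
move=> hc wb hw hb.
pose E := [set x | w <= x <= b /\ forall t, w <= t <= x -> 0 < h t].
have Ew : E w.
  by split=> [|t /andP[t1 t2]]; [lra|have -> : t = w by lra].
have Eb : has_ubound E by exists b => x [xb _]; lra.
have sE : has_sup E by split=> //; exists w.
pose z := sup E; have wz : w <= z by exact: ub_le_sup.
have zb : z <= b by apply: ge_sup; [exists w|move=> x [xb _]; lra].
have below x : w <= x < z -> 0 < h x.
  move=> /andP[wx xz]; have [|e [e1 e2]] := @sup_adherent _ _ (z - x) _ sE.
    lra.
  by move=> ze; apply: e2; rewrite -/z in ze; lra.
have hz : h z = 0.
  apply/eqP; rewrite eq_le; apply/andP; split; rewrite leNgt; apply/negP => hz.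
    have [d d0 H] := cont_delta z hc hz.
    have {}zb : z < b.
      by rewrite lt_neqAle zb andbT; apply/eqP => zb'; move: hz; rewrite zb'; lra.
    pose d' := Num.min (d / 2) (b - z).
    have d'0 : 0 < d' by rewrite lt_min; apply/andP; split; lra.
    have d'1 : d' <= d / 2 by rewrite ge_min lexx.
    have d'2 : d' <= b - z by rewrite ge_min lexx orbT.
    suff : E (z + d') by move/(ub_le_sup Eb); rewrite -/z; lra.
    split=> [|t /andP[t1 t2]]; first lra.
    case: (ltP t z) => tz; first by apply: below; lra.
    have := H t; lra.
  have {}wz : w < z.
    by rewrite lt_neqAle wz andbT; apply/eqP => zw; move: hz; rewrite -zw; lra.
  have [|d d0 H] := @cont_delta h z (- h z) hc; first lra.
  pose d' := Num.min (d / 2) (z - w).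
  have d'0 : 0 < d' by rewrite lt_min; apply/andP; split; lra.
  have d'1 : d' <= d / 2 by rewrite ge_min lexx.
  have d'2 : d' <= z - w by rewrite ge_min lexx orbT.
  have := H (z - d'); have := below (z - d'); lra.
exists z; split=> //.
by rewrite lt_neqAle wz zb !andbT; apply/eqP => zw; move: hz; rewrite -zw; lra.
Qed.

Lemma first_fix g w b : continuous g -> w < b -> w < g w -> g b <= b ->
  exists z, [/\ w < z <= b, g z = z & forall x, w <= x < z -> x < g x].
Proof.
move=> gc wb gw gb.
have [||||z [z1 z2 z3]] := @first_zero (fun x => g x - x) w b.
- by move=> x; apply: cvgB; [exact: gc|exact: cvg_id].
- by [].
- lra.
- lra.
- by exists z; split=> // [|x /z3]; lra.
Qed.

Lemma last_fix g w b : continuous g -> b < w -> w < g w -> g b <= b ->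
  exists z, [/\ b <= z < w, g z = z & forall x, z < x <= w -> x < g x].
Proof.
move=> gc wb gw gb.
(* The substitution [x -> -x] turns a last zero into a first one. *)
have [||||z [z1 z2 z3]] := @first_zero (fun x => g (- x) + x) (- w) (- b).
- move=> x; apply: cvgD; last exact: cvg_id.
  by apply: (@continuous_comp _ _ _ (fun x => - x) g x _ (gc _)); exact: opp_continuous.
- lra.
- rewrite opprK; lra.
- rewrite opprK; lra.
- exists (- z); split=> [||x xz]; [lra|lra|].
  by have := z3 (- x); rewrite opprK; lra.
Qed.

(** The conjugate of [g] by the reflection of [0,1]; results on downward motion follow from those on
    upward motion through it. *)
Definition refl g x := 1 - g (1 - x).

Lemma reflK g : refl (refl g) = g.
Proof. by apply/funext => x; rewrite /refl !subKr. Qed.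

Lemma iter_refl g n x : iter n (refl g) x = 1 - iter n g (1 - x).
Proof. by elim: n => [|n IH] /=; rewrite ?subKr // IH /refl subKr. Qed.

Lemma continuous_refl g : continuous g -> continuous (refl g).
Proof.
move=> gc x; apply: cvgB; first exact: cvg_cst.
apply: (@continuous_comp _ _ _ (fun x => 1 - x) g x _ (gc _)).
by apply: cvgB; [exact: cvg_cst|exact: cvg_id].
Qed.

End ContinuousMaps.

(** * Recurrence and coverings *)

Section Recurrence.
Context {R : realType}.
Implicit Types (f g : R -> R) (v w x y : R) (m n k l : nat).

Lemma recurrent_iter f n x : (0 < n)%N -> recurrent (iter n f) x -> recurrent f x.
Proof.
move=> n0 rx e /rx[k k0]; rewrite -iterM => H.
by exists (k * n)%N; rewrite ?muln_gt0 ?k0.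
Qed.

Lemma iter_fixed (T : Type) (h : T -> T) (t : T) n : h t = t -> iter n h t = t.
Proof. by move=> ht; elim: n => //= n ->. Qed.

Lemma iter_mul_fixed (T : Type) (h : T -> T) (t : T) n k :
  iter n h t = t -> iter (k * n) h t = t.
Proof. by move=> ht; rewrite iterM iter_fixed. Qed.

Lemma away_finite (u : nat -> R) w K :
  (forall j, (j < K)%N -> u j != w) ->
  exists2 e, 0 < e & forall j, (j < K)%N -> e <= `|u j - w|.
Proof.
elim: K => [|K IH] H; first by exists 1.
have [j jK|e e0 He] := IH; first by apply: H; rewrite ltnW.
have uK : 0 < `|u K - w| by rewrite normr_gt0 subr_eq0 H.
exists (Num.min e `|u K - w|); first by rewrite lt_min e0 uK.
move=> j; rewrite ltnS leq_eqVlt => /predU1P[->|jK]; rewrite ge_min ?lexx ?orbT//.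
by rewrite He.
Qed.

(** The orbit of [w] is finite and never returns to [w]: a return would make [w] periodic, whereas
    every further multiple of [m] steps leads to [v]. So the orbit keeps a positive distance from
    [w]. *)
Lemma not_recurrent_preperiodic f m w v : (0 < m)%N -> iter m f w = v ->
  iter m f v = v -> w != v -> ~ recurrent f w.
Proof.
move=> m0 wv vv wNv rw.
have never j : (0 < j)%N -> iter j f w != w.
  move=> j0; apply/eqP => jw.
  have : iter (m * j) f w = w by exact: iter_mul_fixed.
  rewrite mulnC -(prednK j0) mulSn addnC iterD wv iter_mul_fixed // => vw.
  by rewrite vw eqxx in wNv.
have [|e e0 He] := @away_finite (fun j => iter j.+1 f w) w (m + m).
  by move=> j _; exact: never.
have [k k0] := rw _ e0; apply/negP; rewrite -leNgt.
case: (leqP k m) => km.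
  by rewrite -(prednK k0); apply: He; rewrite prednK// (leq_trans km)// leq_addr.
(* From time [m] on the orbit has period [m], so the times up to [2m] suffice. *)
have -> : iter k f w = iter (m + (k - m) %% m) f w.
  rewrite -{1}(subnK (ltnW km)) iterD wv {1}(divn_eq (k - m) m) addnC iterD iter_mul_fixed //.
  by rewrite addnC iterD wv.
rewrite -[X in iter X](prednK (n := (m + _)%N)) ?addn_gt0 ?m0//.
apply: He; rewrite prednK ?addn_gt0 ?m0//.
by rewrite leq_add2l ltnW// ltn_mod.
Qed.

Definition seg a b : set R := [set x | a <= x <= b].

Definition cov f n (A B : set R) := B `<=` iter n f @` A.

Lemma cov_trans f m n A B C : cov f m A B -> cov f n B C -> cov f (m + n) A C.
Proof.
move=> AB BC y /BC[x /AB[w Aw <-] <-]; exists w => //.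
by rewrite addnC iterD.
Qed.

Lemma cov0 f A : cov f 0 A A.
Proof. by move=> x Ax; exists x. Qed.

Lemma cov_mul f m k A : cov f m A A -> cov f (k * m) A A.
Proof.
move=> AA; elim: k => [|k IH]; first exact: cov0.
by rewrite mulSn; exact: cov_trans AA IH.
Qed.

Lemma cov_iter f m n A B : cov (iter m f) n A B -> cov f (n * m) A B.
Proof. by move=> AB y /AB[x Ax <-]; exists x; rewrite ?iterM. Qed.

Lemma cov_sub f n A A' B B' : A `<=` A' -> B' `<=` B -> cov f n A B -> cov f n A' B'.
Proof. by move=> AA' BB' AB y /BB' /AB[x /AA' Ax <-]; exists x. Qed.

(** The intermediate value theorem for [f^n] between [u] and [v], whichever is on the left. *)
Lemma cov_seg f n a b u v c d : continuous f -> seg a b u -> seg a b v ->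
  iter n f u <= c -> d <= iter n f v -> cov f n (seg a b) (seg c d).
Proof.
move=> fc; rewrite /seg /= => abu abv uc dv y /= ycd.
have fnc := @continuous_iter _ f n fc.
case: (leP u v) => uv.
  have [|x xuv <-] := @ivt_up _ _ u v y fnc uv; first lra.
  by exists x => //=; lra.
have [|x xuv <-] := @ivt_down _ _ v u y fnc (ltW uv); first lra.
by exists x => //=; lra.
Qed.

(** An interval one-way horseshoe of order [l] for some iterate of [f], given by endpoints and
    indexed from 0; all horseshoes below are built in this form. *)
Definition chain f l := exists n (a b : nat -> R),
  [/\ (0 < n)%N,
      forall i, (i < l)%N -> [/\ 0 <= a i, a i <= b i & b i <= 1],
      forall i j, (i < j)%N -> (j < l)%N -> b i < a j \/ b j < a i,
      exists2 x, seg (a l.-1) (b l.-1) x & ~ recurrent (iter n f) x &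
      forall i j, (i <= j)%N -> (j < l)%N -> cov f n (seg (a i) (b i)) (seg (a j) (b j))].

Lemma segE a b : seg a b = `[a, b]%classic.
Proof. by apply/seteqP; split=> x /=; rewrite in_itv. Qed.

Lemma chain_orders f l : (0 < l)%N -> chain f l -> interval_horseshoe_orders f l%:R%:E.
Proof.
move=> l0 [n [a [b [n0 ab disj [x xl nx] cv]]]].
exists l => //; exists n, (fun i => seg (a i.-1) (b i.-1)); split=> //; last first.
  move=> i /andP[i0 il]; exists (a i.-1), (b i.-1); split; last exact: segE.
  by case: (ab i.-1) => //; rewrite prednK.
split=> //.
- move=> i /andP[i0 il]; case: (ab i.-1) => [|a0 aib b1]; first by rewrite prednK.
  split; first by move=> y; rewrite /unitI /seg /= in_itv /=; lra.
  by rewrite segE; exact: segment_compact.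
- have H i j : (i < j)%N -> (j < l)%N -> seg (a i) (b i) `&` seg (a j) (b j) = set0.
    move=> ij jl; apply/seteqP; split=> // y [].
    by rewrite /seg /=; case: (disj i j ij jl); lra.
  move=> i j /andP[i0 il] /andP[j0 jl] ij.
  have [ij'|ij'|/eqP] := ltngtP i.-1 j.-1.
  + by apply: H => //; rewrite prednK.
  + by rewrite setIC; apply: H => //; rewrite prednK.
  + by rewrite -eqSS !prednK// => /eqP.
- by exists x.
- move=> i j i1 ij jl; apply: cv; last by rewrite prednK // (leq_trans i1).
  by rewrite -ltnS !prednK // (leq_trans i1).
Qed.

(** The covering times may depend on [i]: as every interval also covers itself, any multiple of its
    time works, which gives a common time [M]. Longer jumps compose single ones. *)
Lemma chain_common f l (a b : nat -> R) :
  (forall i, (i < l)%N -> [/\ 0 <= a i, a i <= b i & b i <= 1]) ->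
  (forall i j, (i < j)%N -> (j < l)%N -> b i < a j \/ b j < a i) ->
  (exists2 x, seg (a l.-1) (b l.-1) x & ~ recurrent f x) ->
  (forall i, (i < l)%N -> exists m, [/\ (0 < m)%N,
     cov f m (seg (a i) (b i)) (seg (a i) (b i)) &
     (i.+1 < l)%N -> cov f m (seg (a i) (b i)) (seg (a i.+1) (b i.+1))]) ->
  chain f l.
Proof.
move=> ab disj nonrec H; pose A i := seg (a i) (b i).
have [M [M0 HM]] : exists M, (0 < M)%N /\ forall i, (i < l)%N ->
    cov f M (A i) (A i) /\ ((i.+1 < l)%N -> cov f M (A i) (A i.+1)).
  suff K k : (k <= l)%N -> exists M, (0 < M)%N /\ forall i, (i < k)%N ->
    cov f M (A i) (A i) /\ ((i.+1 < l)%N -> cov f M (A i) (A i.+1)) by exact: K.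
  have mulcov i m q : (0 < q)%N -> cov f m (A i) (A i) ->
      ((i.+1 < l)%N -> cov f m (A i) (A i.+1)) ->
      cov f (q * m) (A i) (A i) /\ ((i.+1 < l)%N -> cov f (q * m) (A i) (A i.+1)).
    move=> q0 c1 c2; split; first exact: cov_mul.
    move=> /c2 {}c2; rewrite -(prednK q0) mulSnr.
    exact: cov_trans (cov_mul _ c1) c2.
  elim: k => [|k IH] kl; first by exists 1%N.
  have [M [M0 HM]] := IH (ltnW kl); have [m [m0 c1 c2]] := H k kl.
  exists (m * M)%N; rewrite muln_gt0 m0 M0; split=> // i; rewrite ltnS leq_eqVlt.
  case/predU1P => [->|/HM[]]; last exact: mulcov.
  by rewrite mulnC; exact: mulcov.
have lM0 : (0 < l.+1 * M)%N by rewrite muln_gt0 M0.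
exists (l.+1 * M)%N, a, b; split=> //.
  by case: nonrec => x Ax nx; exists x => // /(recurrent_iter lM0).
have step k i : (i + k < l)%N -> cov f (k * M) (A i) (A (i + k)%N).
  elim: k => [|k IH] kl; first by rewrite addn0; exact: cov0.
  rewrite mulSnr; apply: cov_trans (IH _) _; first by lia.
  by rewrite addnS; apply: (HM _ _).2; lia.
(* A jump from [i] to [j] uses [j - i] of the [l.+1] units of time; the others are spent waiting in
   [A i]. *)
move=> i j ij jl; have -> : (l.+1 * M = (l.+1 - (j - i)) * M + (j - i) * M)%N.
  by rewrite -mulnDl subnK //; lia.
apply: (@cov_trans _ _ _ _ (A i)); first by apply: cov_mul; apply: (HM _ _).1; lia.
by have := @step (j - i)%N i; rewrite subnKC//; apply.
Qed.

Lemma chain_iter f m l : (0 < m)%N -> chain (iter m f) l -> chain f l.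
Proof.
move=> m0 [n [a [b [n0 ab disj [x xl nx] cv]]]].
exists (n * m)%N, a, b; split=> //; first by rewrite muln_gt0 n0.
  by exists x => //; move: nx; rewrite (_ : iter n _ = iter (n * m) f)//; apply/funext => z; rewrite iterM.
by move=> i j ij jl; apply: cov_iter; exact: cv.
Qed.

End Recurrence.

(** * Turbulence and period doubling *)

Section Turbulence.
Context {R : realType}.
Implicit Types (f g : R -> R) (p u v w x y z : R) (m n k l : nat).

Lemma recurrent_refl f x : recurrent f (1 - x) -> recurrent (refl f) x.
Proof.
move=> rx e /rx[n n0 H]; exists n => //; rewrite iter_refl.
by rewrite (_ : 1 - _ - x = - (iter n f (1 - x) - (1 - x))) ?normrN//; ring.
Qed.

Lemma refl_iter f n : refl (iter n f) = iter n (refl f).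
Proof. by apply/funext => x; rewrite iter_refl. Qed.

Lemma refl_seg x a b : seg (1 - b) (1 - a) x <-> seg a b (1 - x).
Proof. by rewrite /seg /=; split; lra. Qed.

Lemma cov_refl f n a b c d : cov (refl f) n (seg a b) (seg c d) ->
  cov f n (seg (1 - b) (1 - a)) (seg (1 - d) (1 - c)).
Proof.
move=> H y /refl_seg /H[x xab]; rewrite iter_refl => xy.
exists (1 - x); last by lra.
by apply/refl_seg; rewrite subKr.
Qed.

Lemma chain_refl f l : chain (refl f) l -> chain f l.
Proof.
move=> [n [a [b [n0 ab disj [x xl nx] cv]]]].
exists n, (fun i => 1 - b i), (fun i => 1 - a i); split=> //.
- by move=> i /ab[]; split; lra.
- by move=> i j ij jl; case: (disj i j ij jl); [right|left]; lra.
- exists (1 - x); first by apply/refl_seg; rewrite subKr.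
  by move=> rx; apply: nx; rewrite -refl_iter; exact: recurrent_refl.
- by move=> i j ij jl; apply: cov_refl; exact: cv.
Qed.

(** Under [f^m] both [[p, x]] and [[x, y]] cover [[p, y]]. The fixed point is on the left; the
    mirror image is turbulence of [refl f]. *)
Definition turbulent f m := exists p x y,
  [/\ p < x < y, iter m f p = p, y <= iter m f x & iter m f y <= p].

Definition tame f := forall m, (0 < m)%N -> ~ turbulent f m /\ ~ turbulent (refl f) m.

Definition unit_valued f := forall x, 0 <= f x <= 1.

Lemma unit_valued_iter f m x : unit_valued f -> (0 < m)%N -> 0 <= iter m f x <= 1.
Proof. by move=> f01; case: m => // m _; rewrite iterS. Qed.

Lemma unit_valued_refl f : unit_valued f -> unit_valued (refl f).
Proof. by move=> f01 x; rewrite /refl; have := f01 (1 - x); lra. Qed.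

(* With [G = f^m] and [p < x < y] as in [turbulent], pull [x] back repeatedly
   towards [p]: the fundamental intervals [x_{k+1}, x_k] all eventually cover
   [p, y]. *)
Lemma turbulent_chain f m l : continuous f -> unit_valued f -> (0 < m)%N -> (0 < l)%N ->
  turbulent f m -> chain f l.
Proof.
move=> fc f01 m0 l0 [p [x [y [/andP[px xy] Gp Gx Gy]]]].
pose G := iter m f; have Gc : continuous G by exact: continuous_iter.
have next u : exists u', p < u < G u -> [/\ p < u' < u, u' < G u' & G u' = u].
  case: (boolP (p < u < G u)) => [/andP[pu uG]|_]; last by exists u.
  have [|u' /andP[pu' u'u] Gu'] := @ivt_up _ G p u u Gc (ltW pu).
    by rewrite [G p]Gp; lra.
  exists u' => _; rewrite Gu'.
  have u'p : u' != p by apply/eqP => u'p; move: Gu'; rewrite u'p [G p]Gp; lra.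
  have u'u' : u' != u by apply/eqP => u'e; move: Gu'; rewrite u'e; lra.
  by split=> //; rewrite ?lt_neqAle ?u'u ?u'u' ?pu' ?andbT //= eq_sym.
have [nx nxP] := choice next.
have [xs xs0 xsE] : exists2 xs : nat -> R, xs 0%N = x & forall k, xs k.+1 = nx (xs k).
  by exists (fun k => iter k nx x).
have xsP k : p < xs k < G (xs k).
  elim: k => [|k IH]; first by rewrite xs0 /G; lra.
  by have [? ? ?] := nxP _ IH; rewrite xsE; lra.
have xsS k : xs k.+1 < xs k by case: (nxP _ (xsP k)); rewrite xsE; lra.
have GxsS k : G (xs k.+1) = xs k by rewrite xsE; case: (nxP _ (xsP k)).
have xs_lt k d : xs (k + d.+1)%N < xs k.
  by elim: d => [|d IH]; rewrite ?addn1// addnS; apply: lt_trans IH.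
have xs_le k : xs k <= x by rewrite -xs0; case: k => [//|k]; exact: ltW (xs_lt 0%N k).
have Gxs k : iter k G (xs k) = x by elim: k => //= k; rewrite -iterS iterSr GxsS.
pose L k := seg (xs k.+1) (xs k).
have covpy : cov G 1 (seg x y) (seg p y) by apply: (@cov_seg _ _ _ _ _ y x); rewrite /seg //=; lra.
have covL k : cov G k.+2 (L k) (seg p y).
  rewrite -addn1; apply: (@cov_trans _ _ _ _ _ (seg x y)) => //.
  have e1 : iter k.+1 G (xs k.+1) <= x by rewrite Gxs.
  have e2 : y <= iter k.+1 G (xs k) by rewrite iterS Gxs.
  have Lk1 : L k (xs k.+1) by apply/andP; split=> //; exact: ltW (xsS k).
  have Lk : L k (xs k) by apply/andP; split=> //; exact: ltW (xsS k).
  exact: (cov_seg Gc Lk1 Lk e1 e2).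
have Lpy k : L k `<=` seg p y.
  by move=> t; rewrite /L /seg /=; have := xsP k.+1; have := xs_le k; lra.
have y1 : y <= 1 by have := unit_valued_iter x f01 m0; lra.
have p0 : 0 <= p by have := unit_valued_iter p f01 m0; lra.
(* Neighbouring fundamental intervals share an endpoint, so every second one is taken, from right to
   left. *)
apply: (@chain_common _ f l (fun i => xs (i.*2).+1) (fun i => xs i.*2)).
- move=> i _; have := xsP (i.*2).+1; have := xsS i.*2; have := xs_le i.*2; split; lra.
- move=> i j ij _; right; have -> : (j.*2 = (i.*2).+1 + (j.*2 - (i.*2).+2).+1)%N.
    by rewrite -!muln2; lia.
  exact: xs_lt.
(* The non-recurrent point is a preimage of the fixed point [p]. *)
- have [|w Lw Gw] := covL l.-1.*2 p; first by rewrite /seg /=; lra.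
  exists w => //; apply: (@not_recurrent_preperiodic _ _ ((l.-1.*2).+2 * m) _ p).
  + by rewrite muln_gt0.
  + by rewrite iterM.
  + by rewrite iterM iter_fixed.
  + by move: Lw; rewrite /L /seg /=; have := xsP (l.-1.*2).+1; lra.
- move=> i _; exists ((i.*2).+2 * m)%N; rewrite muln_gt0 m0; split=> //.
    apply: cov_iter; apply: (cov_sub _ _ (covL _)) => //; exact: Lpy.
  move=> _; apply: cov_iter; apply: (cov_sub _ _ (covL _)) => //; exact: Lpy.
Qed.

Lemma tame_of_bounded f L : continuous f -> unit_valued f ->
  (forall l, chain f l -> (l <= L)%N) -> tame f.
Proof.
move=> fc f01 H m m0; split=> T.
  by have := H _ (turbulent_chain fc f01 m0 (ltn0Sn L) T); rewrite ltnn.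
have := turbulent_chain (continuous_refl fc) (unit_valued_refl f01) m0 (ltn0Sn L) T.
by move/chain_refl/H; rewrite ltnn.
Qed.

Lemma tame_refl f : tame f -> tame (refl f).
Proof. by move=> T m /T[T1 T2]; split; rewrite ?reflK. Qed.

Lemma tame_iter f n : (0 < n)%N -> tame f -> tame (iter n f).
Proof.
move=> n0 T m m0; have [T1 T2] : ~ turbulent f (m * n) /\ ~ turbulent (refl f) (m * n).
  by apply: T; rewrite muln_gt0 m0.
by split; rewrite ?refl_iter => -[p [x [y []]]]; rewrite -!iterM => *; [apply: T1|apply: T2];
  exists p, x, y.
Qed.

(** Let [z] be the last fixed point below [w]. The orbit first drops to [z] or below from a point
    [y], and [y > w] since [(z, w]] rises. If [x] precedes the first orbit point that is at least
    [y], then [z < x < y] witness turbulence. *)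
Lemma turbulent_fall g w k : continuous g -> w < g w -> iter k g w < w ->
  g (iter k g w) < iter k g w -> turbulent g 1.
Proof.
move=> gc wU vw vD; set v := iter k g w in vw vD.
have [z [zvw gz zU]] := last_fix gc vw wU (ltW vD).
have vz : v < z.
  by rewrite lt_neqAle; apply/andP; split; [apply/eqP => vz; move: vD; rewrite vz; lra|lra].
have ex1 : exists j, iter j g w <= z by exists k; rewrite -/v; lra.
case: (ex_minnP ex1) => j jz jmin.
case: j => [|j] in jz jmin; first by move: jz => /=; lra.
set y := iter j g w.
have above i : (i <= j)%N -> z < iter i g w.
  by move=> ij; rewrite ltNge; apply/negP => /jmin; rewrite ltnNge ij.
have zy : z < y by exact: above.
have gy : g y <= z by [].
have wy : w < y by rewrite ltNge; apply/negP => yw; have := zU y; lra.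
have ex2 : exists i, y <= iter i g w by exists j.
case: (ex_minnP ex2) => i iy imin.
case: i => [|i] in iy imin; first by move: iy => /=; lra.
have ij : (i < j)%N by exact: imin.
exists z, (iter i g w), y; split=> //.
apply/andP; split; first exact: above (ltnW ij).
by rewrite ltNge; apply/negP => /imin; rewrite ltnn.
Qed.

Lemma last_fix_down g s w : continuous g -> w < s -> g s < s -> w < g w ->
  exists z, [/\ w <= z < s, g z = z & forall x, z < x <= s -> g x < x].
Proof.
move=> gc ws sD wU.
have [||||z [z1 z2 z3]] := @first_fix _ (refl g) (1 - s) (1 - w); rewrite /refl ?subKr; try lra.
  exact: continuous_refl.
exists (1 - z); split; [lra|by move: z2; rewrite /refl; lra|].
by move=> x xz; have := z3 (1 - x); rewrite /refl subKr; lra.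
Qed.

Definition periodic_orbit g y K :=
  [/\ (0 < K)%N, iter K g y = y & forall t, g (iter t g y) != iter t g y].

Lemma periodic_orbit_refl g y K : periodic_orbit g y K -> periodic_orbit (refl g) (1 - y) K.
Proof.
move=> [K0 yK yN]; split=> // [|t]; rewrite iter_refl subKr ?yK//.
by rewrite /refl subKr (inj_eq (can_inj (subKr 1))) yN.
Qed.

Lemma orbit_period g y K t k : periodic_orbit g y K -> iter (t + k * K) g y = iter t g y.
Proof. by move=> [_ yK _]; rewrite iterD iter_mul_fixed. Qed.

(** By periodicity the orbit leads from the rising point to the falling one; if the latter were
    lower, [turbulent_fall] would apply. *)
Lemma orbit_up_lt_down g y K s t : continuous g -> tame g -> periodic_orbit g y K ->
  iter s g y < iter s.+1 g y -> iter t.+1 g y < iter t g y -> iter s g y < iter t g y.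
Proof.
move=> gc gt P; rewrite !iterS => sU tD; rewrite ltNge le_eqVlt; apply/negP => /predU1P[ts|ts].
  by move: sU tD; rewrite ts; lra.
have [T _] := gt _ (ltn0Sn 0); apply: T.
(* The [s] extra periods prevent the subtraction from being truncated. *)
have tE : iter (t + s * K - s) g (iter s g y) = iter t g y.
  rewrite -(orbit_period t s P) -iterD; congr (iter _ g y).
  by case: P => K0 _ _; rewrite subnK // (leq_trans _ (leq_addl _ _)) // leq_pmulr.
by apply: (@turbulent_fall g (iter s g y) (t + s * K - s)); rewrite ?tE.
Qed.

Lemma orbit_exists_up g y K : periodic_orbit g y K -> exists t, iter t g y < iter t.+1 g y.
Proof.
move=> [K0 yK yN]; apply: contrapT => /forallNP H.
have dec t : iter t.+1 g y < y.
  have step k : iter k.+1 g y < iter k g y.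
    by rewrite lt_neqAle iterS yN leNgt; apply/negP; exact: H.
  elim: t => [|t IH]; first exact: step.
  exact: lt_trans (step _) IH.
by have := dec K.-1; rewrite prednK// yK ltxx.
Qed.

Lemma orbit_exists_down g y K : periodic_orbit g y K -> exists t, iter t.+1 g y < iter t g y.
Proof.
move/periodic_orbit_refl/orbit_exists_up => [t]; rewrite !iter_refl !subKr => ?.
by exists t; lra.
Qed.

(** Let [sup E] be the supremum of the rising orbit points, which all lie below the falling ones.
    Then [z] is [sup E] if that is fixed, and otherwise the nearest fixed point on the side to which
    [sup E] moves. *)
Lemma orbit_separation g y K : continuous g -> tame g -> periodic_orbit g y K ->
  exists2 z, g z = z & forall t, (iter t g y < iter t.+1 g y -> iter t g y < z) /\
    (iter t.+1 g y < iter t g y -> z < iter t g y).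
Proof.
move=> gc gt P; have [s0 s0U] := orbit_exists_up P; have [t0 t0D] := orbit_exists_down P.
have [K0 yK yN] := P.
pose E := [set x | exists2 t, x = iter t g y & iter t g y < iter t.+1 g y].
have ubE t : iter t.+1 g y < iter t g y -> ubound E (iter t g y).
  by move=> tD x [s -> sU]; apply/ltW/(orbit_up_lt_down gc gt P).
have sE : has_sup E by split; [exists (iter s0 g y), s0|exists (iter t0 g y); exact: ubE].
have Us t : iter t g y < iter t.+1 g y -> iter t g y <= sup E.
  by move=> tU; apply: ub_le_sup; [case: sE|exists t].
have sD t : iter t.+1 g y < iter t g y -> sup E <= iter t g y.
  by move=> tD; apply: ge_sup; [case: sE|exact: ubE].
have neq z t : g z = z -> iter t g y != z.
  by move=> gz; apply/eqP => tz; have := yN t; rewrite tz gz eqxx.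
have [sU|sDn|gs] := ltgtP (sup E) (g (sup E)).
- have lt0 : sup E < iter t0 g y.
    by rewrite lt_neqAle sD// andbT; apply/eqP => st; move: sU; rewrite st -iterS; lra.
  have [z [z1 z2 z3]] := first_fix gc lt0 sU (ltW t0D).
  exists z => // t; split=> [tU|tD]; first by have := Us _ tU; lra.
  rewrite lt_neqAle eq_sym neq//= leNgt; apply/negP => tz.
  by have := z3 (iter t g y); have := sD _ tD; move: tD; rewrite iterS; lra.
- have lt0 : iter s0 g y < sup E.
    by rewrite lt_neqAle Us// andbT; apply/eqP => st; move: sDn; rewrite -st -iterS; lra.
  have [z [z1 z2 z3]] := last_fix_down gc lt0 sDn s0U.
  exists z => // t; split=> [tU|tD]; last by have := sD _ tD; lra.
  rewrite lt_neqAle neq//= leNgt; apply/negP => tz.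
  by have := z3 (iter t g y); have := Us _ tU; move: tU; rewrite iterS; lra.
- exists (sup E) => // t; split=> tx.
    by rewrite lt_neqAle neq// Us.
  by rewrite lt_neqAle eq_sym neq// sD.
Qed.

(** Otherwise the orbit climbs below [z] until a last point [u] before crossing, and [g r = z] for
    some [r] between the starting point and [u]. Periodicity brings [u] back to the starting point,
    so [z], [u], [r] are turbulent after reflection. *)
Lemma orbit_alternate_up g y K z : continuous g -> tame g -> periodic_orbit g y K ->
  g z = z -> (forall t, (iter t g y < iter t.+1 g y -> iter t g y < z) /\
    (iter t.+1 g y < iter t g y -> z < iter t g y)) ->
  forall t, iter t g y < z -> z < iter t.+1 g y.
Proof.
move=> gc gt P gz sep t tz; have [K0 yK yN] := P.
have up s : iter s g y < z -> iter s g y < iter s.+1 g y.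
  move=> sz; rewrite ltNge le_eqVlt iterS (negbTE (yN s)) /=.
  by apply/negP => /(sep s).2; lra.
rewrite ltNge le_eqVlt; apply/negP => /predU1P[tz1|tz1].
  by have := yN t.+1; rewrite tz1 gz eqxx.
have [d dD] := orbit_exists_down P.
have exj : exists j, z < iter (t.+1 + j) g y.
  exists (d + t.+1 * K - t.+1)%N; rewrite subnKC; last first.
    by rewrite (leq_trans _ (leq_addl _ _)) // leq_pmulr.
  by rewrite (orbit_period _ _ P); exact: (sep d).2.
case: (ex_minnP exj) => j jz jmin.
case: j => [|j] in jz jmin; first by move: jz; rewrite addn0; lra.
have below i : (i <= j)%N -> iter (t.+1 + i) g y < z.
  move=> ij; rewrite lt_neqAle leNgt; apply/andP; split.
    by apply/eqP => e; have := yN (t.+1 + i)%N; rewrite e gz eqxx.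
  by apply/negP => /jmin; rewrite ltnNge ij.
have incr i : (i <= j)%N -> iter t g y < iter (t.+1 + i) g y.
  elim: i => [_|i IH ij]; first by rewrite addn0 up.
  rewrite addnS; apply: lt_trans (IH (ltnW ij)) _; apply: up; exact: below (ltnW ij).
set u := iter (t.+1 + j) g y.
have uz : u < z by exact: below.
have tu : iter t g y < u by exact: incr.
have [|r rtu gr] := @ivt_up _ g (iter t g y) u z gc (ltW tu).
  by rewrite -iterS (ltW tz1) /=; move: jz; rewrite addnS iterS -/u => /ltW.
have ru : r != u by apply/eqP => e; move: jz; rewrite addnS iterS -/u -e gr ltxx.
(* The time from [u] back to the starting point; the added periods make it positive. *)
pose m := ((t.+1 + j).+1 * K - (t.+1 + j) + t)%N.
have Nm : (t.+1 + j <= (t.+1 + j).+1 * K)%N by rewrite (leq_trans _ (leq_pmulr _ K0)).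
have m0 : (0 < m)%N.
  by rewrite addn_gt0 subn_gt0 (leq_trans _ (leq_pmulr _ K0)).
have gmu : iter m g u = iter t g y.
  rewrite /u -iterD /m -addnA (addnC t) addnA subnK// addnC.
  exact: orbit_period P.
have gmz : iter m g z = z by exact: iter_fixed.
have gmr : iter m g r = z by rewrite -(prednK m0) iterSr gr iter_fixed.
have [_ T] := gt _ m0; apply: T; exists (1 - z), (1 - u), (1 - r).
rewrite !iter_refl !subKr gmu gmz gmr; split=> //; last lra.
by have : r < u; [rewrite lt_neqAle ru; lra|lra].
Qed.

Lemma orbit_alternate g y K : continuous g -> tame g -> periodic_orbit g y K ->
  exists2 z, g z = z & forall t,
    (iter t g y < z /\ z < iter t.+1 g y) \/ (z < iter t g y /\ iter t.+1 g y < z).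
Proof.
move=> gc gt P; have [z gz sep] := orbit_separation gc gt P.
exists z => // t; have [K0 yK yN] := P.
have [tz|tz|tz] := ltgtP (iter t g y) z.
- by left; split=> //; apply: (orbit_alternate_up gc gt P gz sep).
- right; split=> //.
  have := @orbit_alternate_up (refl g) (1 - y) K (1 - z) (continuous_refl gc)
    (tame_refl gt) (periodic_orbit_refl P) _ _ t.
  rewrite !iter_refl !subKr => H.
  suff : 1 - z < 1 - iter t.+1 g y by lra.
  apply: H; [by rewrite /refl subKr gz| |lra].
  move=> s; rewrite !iter_refl !subKr; have [s1 s2] := sep s; split=> sx.
    by have := s2; lra.
  by have := s1; lra.
- by have := yN t; rewrite tz gz eqxx.
Qed.

End Turbulence.

(** * Horseshoes from orbits of period a power of two *)

Section PeriodDoubling.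
Context {R : realType}.
Implicit Types (f g : R -> R) (p u v w x y z : R) (m n k l : nat).

Lemma arg_min_below (u : nat -> R) K : exists s, forall t, (t <= K)%N -> u s <= u t.
Proof.
elim: K => [|K [s sP]]; first by exists 0%N => t; rewrite leqn0 => /eqP ->.
have [sK|Ks] := leP (u s) (u K.+1).
  by exists s => t; rewrite leq_eqVlt => /predU1P[->//|]; exact: sP.
exists K.+1 => t; rewrite leq_eqVlt => /predU1P[->//|/sP].
exact/le_trans/ltW.
Qed.

Lemma periodic_arg_min g y P : (0 < P)%N -> iter P g y = y ->
  exists s, forall t, iter s g y <= iter t g y.
Proof.
move=> P0 yP; have [s sP] := arg_min_below (fun t => iter t g y) P.
exists s => t; rewrite (divn_eq t P) addnC iterD iter_mul_fixed//.
by apply: sP; rewrite ltnW// ltn_mod.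
Qed.

Lemma exact_period_shift g y o P Q : (0 < P)%N -> iter P g y = y -> iter Q g y != y ->
  iter P g (iter o g y) = iter o g y /\ iter Q g (iter o g y) != iter o g y.
Proof.
move=> P0 yP yQ; split; first by rewrite -iterD addnC iterD yP.
have back : iter (o * P - o) g (iter o g y) = y.
  by rewrite -iterD subnK ?leq_pmulr// iter_mul_fixed.
apply: contra yQ => /eqP e; apply/eqP.
by rewrite -[in LHS]back -iterD addnC iterD e back.
Qed.

Lemma exact_period_orbit g y n : iter (2 ^ n.+1) g y = y -> iter (2 ^ n) g y != y ->
  periodic_orbit g y (2 ^ n.+1).
Proof.
move=> yP yQ; split=> [|//|t]; first by rewrite expn_gt0.
apply: contra yQ => /eqP tf.
have yt : y = iter t g y.
  rewrite -[LHS](@iter_mul_fixed _ g y _ t yP).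
  rewrite -(@subnK t (t * 2 ^ n.+1)) ?leq_pmulr ?expn_gt0//.
  by rewrite iterD iter_fixed.
by rewrite iter_fixed// yt.
Qed.

(* [Z i] separates the two halves of an orbit of [g^(2^i)] contained in the
   upper half of the previous one, and [U i] is the least point of the new
   upper half. *)
Definition ladder g y n (Z U : nat -> R) :=
  [/\ forall t, iter t g y < Z 0%N -> U 0%N <= iter t.+1 g y,
      exists t, iter t g y < Z 0%N,
      forall i, (i <= n)%N -> Z i < U i /\ iter (2 ^ i) g (Z i) = Z i &
      forall i, (i < n)%N -> U i < Z i.+1 /\ U i.+1 <= iter (2 ^ i.+1) g (U i)].

(** By alternation the [g^2]-orbit of a point [w] above [z] stays above [z], and has a least point
    [u]; points below [z] are sent into this half. *)
Lemma upper_half n g y : continuous g -> tame g ->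
  iter (2 ^ n.+1) g y = y -> iter (2 ^ n) g y != y ->
  exists z w u, [/\ g z = z /\ z < u,
    forall t, iter t g y < z -> u <= iter t.+1 g y,
    exists t, iter t g y < z,
    (exists s, u = iter s (iter 2 g) w) /\ (forall t, u <= iter t (iter 2 g) w) &
    exists q, w = iter q g y].
Proof.
move=> gc gt yP yQ; have P := exact_period_orbit yP yQ.
have [z gz alt] := orbit_alternate gc gt P.
have [q q1 zq] : exists2 q, (q <= 1)%N & z < iter q g y.
  by case: (alt 0%N) => -[z1 z2]; [exists 1%N|exists 0%N].
have up s : z < iter (s * 2 + q) g y.
  elim: s => // s IH; rewrite mulSn -addnA !addSn add0n.
  by case: (alt (s * 2 + q)%N) => -[? ?]; case: (alt (s * 2 + q).+1) => -[? ?]; lra.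
have hE s : iter s (iter 2 g) (iter q g y) = iter (s * 2 + q) g y by rewrite -iterM -iterD.
have [s smin] : exists s, forall t, iter s (iter 2 g) (iter q g y) <= iter t (iter 2 g) (iter q g y).
  apply: (@periodic_arg_min _ _ (2 ^ n.+1)); first by rewrite expn_gt0.
  by rewrite hE addnC mulnC orbit_period.
exists z, (iter q g y), (iter s (iter 2 g) (iter q g y)); split=> //.
- by split=> //; rewrite hE up.
(* Times of the parity of [q] are spent above [z], so [t.+1] has this parity and [t] has not. *)
- move=> t tz; have [k [tk|tk]] : exists k, (t.+1 = k * 2 + q \/ t = k * 2 + q)%N.
    by exists ((t.+1 - q) %/ 2)%N; lia.
  + by rewrite tk -hE.
  + by have := up k; rewrite -tk; lra.
- by exists q.+1; have := up 0%N; case: (alt q) => -[? ?] ?; lra.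
- by split=> //; exists s.
- by exists q.
Qed.

(** Induction on [n]: the upper half is an orbit of [g^2] with half the period, and its ladder is
    shifted by one level. *)
Lemma ladder_exists n g y : continuous g -> tame g ->
  iter (2 ^ n.+1) g y = y -> iter (2 ^ n) g y != y -> exists Z U, ladder g y n Z U.
Proof.
elim: n g y => [|n IH] g y gc gt yP yQ.
  have [z [w [u [[gz zu] dn ex _ _]]]] := upper_half gc gt yP yQ.
  exists (fun=> z), (fun=> u); split=> // i; rewrite leqn0 => /eqP ->.
  by rewrite expn0.
have [z [w [u [[gz zu] dn ex [[s us] umin] [q wq]]]]] := upper_half gc gt yP yQ.
have [||||Z [U [L1 [t0 t0Z] L3 L4]]] := IH (iter 2 g) w.
- exact: continuous_iter.
- exact: tame_iter.
- rewrite -iterM -expnSr wq.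
  by apply: (exact_period_shift _ _ yP yQ).1; rewrite expn_gt0.
- rewrite -iterM -expnSr wq.
  by apply: (exact_period_shift _ _ yP yQ).2; rewrite expn_gt0.
exists (fun i => if i is j.+1 then Z j else z), (fun i => if i is j.+1 then U j else u).
have hE k x : iter (2 ^ k) (iter 2 g) x = iter (2 ^ k.+1) g x by rewrite -iterM -expnSr.
have uZ : u < Z 0%N by apply: le_lt_trans t0Z.
split=> //.
- move=> [_|i /L3]; first by rewrite expn0.
  by rewrite hE.
- move=> [_|i /L4]; last by rewrite hE.
  (* The least point [u] of the upper half lies below the next separating point, so [g^2] lifts it
     into the next upper half. *)
  split=> //; rewrite expn1; rewrite us in uZ *.
  exact: L1.
Qed.

(** Under the iterate [2 ^ i.+1] the point [Z i] is fixed and [U i] goes to [U i.+1] or above, so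
    [[Z i, U i]] covers itself and the next interval. A preimage of the periodic point [Z n.+1] in
    the last interval is non-recurrent. *)
Lemma period_doubling_chain f y n : continuous f -> unit_valued f -> tame f ->
  iter (2 ^ n.+2) f y = y -> iter (2 ^ n.+1) f y != y -> chain f n.+1.
Proof.
move=> fc f01 ft yP yQ; have [Z [U [_ _ L3 L4]]] := ladder_exists fc ft yP yQ.
have ZU i : (i <= n)%N -> [/\ Z i < U i, U i < Z i.+1 & Z i.+1 < U i.+1].
  by move=> i_n; split; [apply: (L3 i _).1; lia|apply: (L4 i _).1; lia|apply: (L3 i.+1 _).1; lia].
have fixZ i m : (i <= n.+1)%N -> (i <= m)%N -> iter (2 ^ m) f (Z i) = Z i.
  by move=> i_n im; rewrite -(subnK im) expnD iter_mul_fixed//; exact: (L3 i i_n).2.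
have Zlt i d : (i + d <= n)%N -> U i < Z (i + d).+1.
  elim: d => [|d IH] id_; first by rewrite addn0; case: (ZU i) => //; lia.
  have [] := ZU (i + d).+1; first by lia.
  rewrite addnS => ? ? _; have := IH; rewrite ltnW; last by lia.
  by have [|? ? ?] := ZU (i + d)%N; [lia|move/(_ isT); lra].
have Z01 i : (i <= n.+1)%N -> 0 <= Z i <= 1.
  by move=> i_n; rewrite -(fixZ i i)//; apply: unit_valued_iter; rewrite ?expn_gt0.
have covZ i : (i <= n)%N -> cov f (2 ^ i.+1) (seg (Z i) (U i)) (seg (Z i) (U i.+1)).
  move=> i_n; have [z1 z2 z3] := ZU i i_n.
  apply: (@cov_seg _ _ _ _ _ (Z i) (U i)) => //; rewrite /seg /=; try lra.
    by rewrite fixZ //; lia.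
  by apply: (L4 i _).2; lia.
apply: (@chain_common _ f n.+1 Z U).
- move=> i i_n; have [z1 z2 z3] := ZU i i_n.
  have /andP[Zi0 _] := Z01 i (leqW i_n); have /andP[_ Zi1] := Z01 i.+1 i_n.
  by split; lra.
- move=> i j ij jn; left; have := Zlt i (j - i.+1)%N; rewrite -addSn subnKC//; apply; lia.
- have [z1 z2 z3] := ZU n (leqnn n).
  have [|w wA wZ] := covZ n (leqnn n) (Z n.+1); first by rewrite /seg /=; lra.
  exists w => //; apply: not_recurrent_preperiodic wZ _ _.
  + by rewrite expn_gt0.
  + exact: fixZ.
  + by move: wA; rewrite /seg /=; lra.
- move=> i i_n; have [z1 z2 z3] := ZU i i_n; exists (2 ^ i.+1)%N; rewrite expn_gt0; split=> //.
    by apply: (cov_sub _ _ (covZ i i_n)) => // x; rewrite /seg /=; lra.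
  by move=> _; apply: (cov_sub _ _ (covZ i i_n)) => // x; rewrite /seg /=; lra.
Qed.

End PeriodDoubling.

(** * Maps without 2-cycles *)

Section NoTwoCycle.
Context {R : realType}.
Implicit Types (f g : R -> R) (c x y : R) (m n k l : nat).

Definition no_2cycle g := forall x, g (g x) = x -> g x = x.

Definition persistent g := forall x n, x < g x -> x < iter n.+1 g x.

Lemma no_2cycle_refl g : no_2cycle g -> no_2cycle (refl g).
Proof.
move=> g2 x; rewrite /refl !subKr => H.
by rewrite g2 ?subKr//; lra.
Qed.

(** If [g (g c) < c], then [g \o g] has a fixed point in an interval [(x0, c]] of points rising
    under [g], as soon as [x0] rises under [g \o g]. This fixed point would lie on a 2-cycle. *)
Lemma two_step_up g c : continuous g -> unit_valued g -> no_2cycle g ->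
  c < g c -> c < g (g c).
Proof.
move=> gc g01 g2 cU; rewrite ltNge le_eqVlt; apply/negP => /predU1P[/g2|cD]; first lra.
have [x0 x0c [x0U x0up]] : exists2 x0, x0 < c &
    x0 < g (g x0) /\ forall x, x0 < x <= c -> x < g x.
  case: (pselect (exists2 b, b < c & g b <= b)) => [[b bc bD]|nob].
    (* Close enough to the right of the last fixed point [p], a point and its image both lie in the
       rising interval [(p, c)]. *)
    have [p [/andP[bp pc] gp pU]] := last_fix gc bc cU bD.
    have [|d d0 H] := @cont_delta _ g p (c - p) gc; first lra.
    pose e := Num.min (d / 2) ((c - p) / 2).
    have e0 : 0 < e by rewrite lt_min; apply/andP; split; lra.
    have e1 : e <= d / 2 by rewrite ge_min lexx.
    have e2 : e <= (c - p) / 2 by rewrite ge_min lexx orbT.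
    have U1 := pU (p + e); have gx := H (p + e); have U2 := pU (g (p + e)).
    by exists (p + e); [lra|split=> [|x xc]; [lra|apply: pU; lra]].
  have up x : x <= c -> x < g x.
    rewrite le_eqVlt => /predU1P[->//|xc]; rewrite ltNge; apply/negP => xD.
    by apply: nob; exists x.
  (* All points up to [c] rise; a negative point also rises under [g \o g], whose values lie in
     [0,1]. *)
  exists (Num.min (- 1) (c - 1)); first by rewrite gt_min; apply/orP; right; lra.
  split=> [|x xc]; last by apply: up; lra.
  have := g01 (g (Num.min (- 1) (c - 1))).
  have : Num.min (- 1) (c - 1) <= -1 :> R by rewrite ge_min lexx.
  lra.
have gg : continuous (g \o g) by move=> x; apply: continuous_comp; exact: gc.
have [z [zx /= ggz zU]] := @first_fix _ (g \o g) x0 c gg x0c x0U (ltW cD).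
by have := x0up z; rewrite (g2 z ggz); lra.
Qed.

(** Consider the first return to [c] or below, at time [n.+3]. By induction the points at times 1 to
    [n.+2] fall, since one that rose would remain above [c]. With [z] the first fixed point above
    [c], some [x] in [[c, z)] has the image [iter n.+2 g c]; then [g (g x) <= c <= x], although [x]
    rises. *)
Lemma no_2cycle_persistent g : continuous g -> unit_valued g -> no_2cycle g -> persistent g.
Proof.
move=> gc g01 g2 c n; elim/ltn_ind: n c => n IH c cU; rewrite ltNge; apply/negP => nc.
have two x := two_step_up gc g01 g2 (c := x).
case: n => [|[|n]] in IH nc; first by move: nc; rewrite /=; lra.
  by have := two c cU; move: nc; rewrite /=; lra.
have above j : (0 < j)%N -> (j <= n.+2)%N -> c < iter j g c.
  by case: j => // j _ jn; exact: IH.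
have down j : (0 < j)%N -> (j <= n.+2)%N -> iter j.+1 g c < iter j g c.
  move=> j0 jn; have cj := above j j0 jn.
  have E : iter n.+3 g c = iter (n.+2 - j).+1 g (iter j g c).
    by rewrite -iterD; congr (iter _ g c); lia.
  rewrite ltNge le_eqVlt iterS; apply/negP => /predU1P[jf|jU].
    by move: nc; rewrite E iter_fixed //; lra.
  have /IH/(_ _ jU) : (n.+2 - j < n.+2)%N by lia.
  by rewrite -E; lra.
have first_ge : iter n.+2 g c <= g c.
  suff K i : (i <= n.+1)%N -> iter i.+1 g c <= g c by exact: K.
  elim: i => // i IHi i_n; apply: le_trans (IHi (ltnW i_n)); apply/ltW/down => //.
  exact: leqW.
have cn := above n.+2 isT (leqnn _).
have nD : g (iter n.+2 g c) <= c by [].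
have [|z [/andP[cz zn] gz zU]] := @first_fix _ g c (iter n.+2 g c) gc cn cU; first lra.
have zn' : z < iter n.+2 g c.
  by rewrite lt_neqAle zn andbT; apply/eqP => e; move: nD; rewrite -e gz; lra.
have [|x /andP[cx xz] gx] := @ivt_down _ g c z (iter n.+2 g c) gc (ltW cz).
  by rewrite gz zn first_ge.
have {}xz : x < z.
  by rewrite lt_neqAle xz andbT; apply/eqP => e; move: gx; rewrite e gz; lra.
by have := two x (zU x _); rewrite gx; lra.
Qed.

(** A 2-cycle of the iterate [2 ^ L.+1] would have a period [2 ^ L.+2] but not [2 ^ L.+1], and yield
    a chain of order [L.+1]. *)
Lemma persistent_of_bounded f L : continuous f -> unit_valued f ->
  (forall l, chain f l -> (l <= L)%N) ->
  exists2 m, (0 < m)%N & persistent (iter m f) /\ persistent (refl (iter m f)).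
Proof.
move=> fc f01 H; have ft := tame_of_bounded fc f01 H.
exists (2 ^ L.+1)%N; first by rewrite expn_gt0.
have n2 : no_2cycle (iter (2 ^ L.+1) f).
  move=> x; rewrite -iterD addnn -mul2n -expnS => xP; apply/eqP/negPn/negP => xQ.
  by have /H := period_doubling_chain fc f01 ft xP xQ; rewrite ltnn.
have fmc : continuous (iter (2 ^ L.+1) f) by exact: continuous_iter.
have fm01 : unit_valued (iter (2 ^ L.+1) f).
  by move=> x; apply: unit_valued_iter; rewrite ?expn_gt0.
split; first exact: no_2cycle_persistent.
apply: no_2cycle_persistent; [exact: continuous_refl|exact: unit_valued_refl|].
exact: no_2cycle_refl.
Qed.

End NoTwoCycle.

(** * Intervals moved away from a fixed point *)

Section UpIntervals.
Context {R : realType}.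
Implicit Types (f g h : R -> R) (a b c e p q x y t : R) (m n k l : nat).

Lemma persistent_ge g n x : persistent g -> x <= g x -> x <= iter n g x.
Proof.
move=> gp; rewrite le_eqVlt => /predU1P[xf|xU]; first by rewrite iter_fixed.
by case: n => [//|n]; apply/ltW/gp.
Qed.

Lemma persistent_lt_down g n x : persistent (refl g) -> g x < x -> iter n.+1 g x < x.
Proof.
move=> gp xD; have := gp (1 - x) n; rewrite iter_refl /refl !subKr => H.
by have := H; lra.
Qed.

(** A point of the orbit close to [x] rises by continuity, so the orbit never gets below it again.
    Only the finitely many earlier points could be closer to [x], and none of them equals [x]. *)
Lemma persistent_nonrecurrent_up g x : continuous g -> persistent g -> x < g x -> ~ recurrent g x.
Proof.
move=> gc gp xU rx.
have [|d d0 H] := @cont_delta _ g x ((g x - x) / 2) gc; first lra.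
have [|n n0] := rx (Num.min d ((g x - x) / 2)).
  by rewrite lt_min d0; lra.
rewrite lt_min !ltr_norml => /andP[n1 n2].
have xn : x < iter n g x by rewrite -(prednK n0); exact: gp.
have nU : iter n g x <= g (iter n g x) by have := H (iter n g x); lra.
have [|e e0 He] := @away_finite _ (fun j => iter j.+1 g x) x n.
  by move=> j _; rewrite gt_eqF// gp.
have [k k0 kx] := rx _ e0.
case: (leqP k n) => kn.
  by have := He k.-1; rewrite prednK// kn => /(_ isT); rewrite leNgt kx.
have : iter n g x <= iter k g x by rewrite -(subnK (ltnW kn)) iterD persistent_ge.
have := He n.-1; rewrite prednK// leqnn => /(_ isT); move: kx.
rewrite !ger0_norm ?subr_ge0 //; try lra.
by rewrite -(prednK k0); apply/ltW/gp.
Qed.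

Lemma persistent_nonrecurrent g x : continuous g -> persistent g -> persistent (refl g) ->
  g x != x -> ~ recurrent g x.
Proof.
move=> gc gp gp'; rewrite neq_lt => /orP[xD|xU]; last exact: persistent_nonrecurrent_up.
move=> rx; have /(_ (1 - x)) := @persistent_nonrecurrent_up (refl g) _ (continuous_refl gc) gp'.
by apply; [rewrite /refl subKr; lra|apply: recurrent_refl; rewrite subKr].
Qed.

Lemma pos_min_compact (T : topologicalType) (h : T -> R) (K : set T) :
  continuous h -> compact K ->
  (forall z, K z -> 0 < h z) -> exists2 d, 0 < d & forall z, K z -> d <= h z.
Proof.
move=> hc Kc hK; have [->|K0] := eqVneq K set0; first by exists 1.
have [|c /set_mem Kx cmin] := @compact_EVT_min _ _ h K _ Kc (continuous_subspaceT hc).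
  exact/set0P.
by exists (h c); [exact: hK|move=> x /mem_set; exact: cmin].
Qed.

(** On the compact interval [[y, q]] every step gains at least a fixed [d > 0]. *)
Lemma climb g y q : continuous g -> (forall x, y <= x <= q -> x < g x) ->
  exists j, q <= iter j g y.
Proof.
move=> gc H; have [qy|yq] := leP q y; first by exists 0%N.
have [|||d d0 dP] := @pos_min_compact _ (fun x => g x - x) (seg y q).
- by move=> x; apply: cvgB; [exact: gc|exact: cvg_id].
- by rewrite segE; exact: segment_compact.
- by move=> x /H; lra.
apply: contrapT => /forallNP N.
have lb j : y + d *+ j <= iter j g y < q.
  elim: j => [|j /andP[IH1 IH2]]; first by rewrite mulr0n addr0 /= lexx yq.
  apply/andP; split; last by rewrite ltNge; apply/negP/N.
  have jd : 0 <= d *+ j by rewrite mulrn_wge0// ltW.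
  have := dP (iter j g y); rewrite /seg /= mulrS => K.
  have : d <= g (iter j g y) - iter j g y by apply: K; lra.
  lra.
pose k := Num.bound ((q - y) / d).
have : (q - y) / d < k%:R by apply: archi_boundP; rewrite divr_ge0//; lra.
rewrite ltr_pdivrMr // mulrC mulr_natr => ?.
have := lb k; lra.
Qed.

Definition up_int g a q := [/\ g a = a, a < q & forall x, a < x <= q -> x < g x].

Lemma up_int_self g a q : continuous g -> up_int g a q -> cov g 1 (seg a q) (seg a q).
Proof.
move=> gc [ga aq H]; have qU : q < g q by apply: H; lra.
by apply: (@cov_seg _ _ _ _ _ a q) => //; rewrite /seg /=; lra.
Qed.

Lemma up_int_fixed g a q b : up_int g a q -> g b = b -> a < b -> q < b.
Proof. by move=> [ga aq H] gb ab; rewrite ltNge; apply/negP => bq; have := H b; lra. Qed.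

Lemma up_int_ge g a q x n : persistent g -> up_int g a q -> a <= x <= q -> a <= iter n g x.
Proof.
move=> gp [ga aq H] /andP[]; rewrite le_eqVlt => /predU1P[<-|ax] xq.
  by rewrite iter_fixed.
apply: le_trans (ltW ax) _; apply: persistent_ge => //; apply/ltW/H; lra.
Qed.

(** While [a] stays fixed, the orbit of [x] passes [a'] and then climbs to [q']. The initial
    self-covering makes the time positive. *)
Lemma up_cover_up g a q a' q' x n : continuous g -> up_int g a q -> up_int g a' q' ->
  a < a' -> a <= x <= q -> a' < iter n g x ->
  exists2 k, (0 < k)%N & cov g k (seg a q) (seg a' q').
Proof.
move=> gc aq aq' aa' xaq a'y; have [ga aq1 H] := aq; have [ga' aq1' H'] := aq'.
have [j jq'] : exists j, q' <= iter j g (iter n g x).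
  by apply: climb => // t t1; apply: H'; lra.
exists (1 + (j + n))%N => //; apply: (cov_trans (up_int_self gc aq)).
apply: (@cov_seg _ _ _ _ _ a x) => //; rewrite /seg /=; try lra.
  by rewrite iter_fixed//; lra.
by rewrite iterD.
Qed.

(** If some orbit from [[a, q]] reaches [b], the covering follows from the intermediate value
    theorem. Otherwise these orbits stay below [max(q', max g)], the inner maximum being over
    [[a, q']], because they fall between [q'] and [b]; if even [q'] is never reached, [b - q'] is a
    sufficient gap. *)
Lemma up_cover_down g a q b q' : continuous g -> persistent g -> up_int g a q ->
  g b = b -> q' < b -> (forall x, q' <= x < b -> g x < x) -> a < b ->
  q < q' /\ ((exists2 k, (0 < k)%N & cov g k (seg a q) (seg q' b)) \/
    (exists2 t, 0 < t & forall x n, a <= x <= q -> iter n g x <= b - t)).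
Proof.
move=> gc gp aq gb q'b D ab; have [ga aq1 H] := aq.
have qb : q < b by apply: up_int_fixed aq gb ab.
have aq' : a < q' by rewrite ltNge; apply/negP => q'a; have := D a; lra.
have qq' : q < q' by rewrite ltNge; apply/negP => q'q; have := D q; have := H q; lra.
split=> //.
case: (pselect (exists x n, a <= x <= q /\ b <= iter n g x)) => [[x [n [xaq bn]]]|noreach].
  left; exists (1 + n)%N => //; apply: (cov_trans (up_int_self gc aq)).
  apply: (@cov_seg _ _ _ _ _ a x) => //; rewrite /seg /=; try lra.
  by rewrite iter_fixed//; lra.
right; have lt_b x n : a <= x <= q -> iter n g x < b.
  by move=> xaq; rewrite ltNge; apply/negP => bn; apply: noreach; exists x, n.
case: (pselect (exists x n, a <= x <= q /\ q' <= iter n g x)) => [[x0 [n0 [x0q q'n]]]|noq'];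
    last first.
  exists (b - q'); first lra.
  move=> x n xaq; rewrite subKr leNgt; apply/negP => q'n; apply: noq'; exists x, n.
  by split=> //; lra.
have [c caq' cmax] := @EVT_max R g a q' (ltW aq') (continuous_subspaceT gc).
rewrite in_itv /= in caq'.
(* The maximum point [c] is itself an iterate of a point of [[a, q]], so its image stays below
   [b]. *)
have gcb : g c < b.
  have [||x xa0 <-] := @ivt_up _ (iter n0 g) a x0 c (continuous_iter gc).
  - lra.
  - by rewrite iter_fixed//; lra.
  - by rewrite -iterS; apply: lt_b; lra.
exists (b - Num.max q' (g c)); first by rewrite subr_gt0 gt_max q'b.
move=> x n xaq; rewrite subKr; elim: n => [|n IH]; first by rewrite le_max /=; lra.
have an : a <= iter n g x by exact: up_int_ge aq xaq.
have bn := lt_b x n xaq.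
have [nq'|nq'] := leP (iter n g x) q'.
  have /cmax gn : iter n g x \in `[a, q'] by rewrite in_itv /= an nq'.
  by rewrite le_max iterS gn orbT.
by apply: le_trans IH; rewrite iterS; apply/ltW/D; lra.
Qed.

(** Each of the finitely many windows of length [e] contains at most [L] points of [A]. *)
Lemma finite_windows (A : set R) e L : 0 < e -> A `<=` [set x | 0 <= x <= 1] ->
  (forall s : seq R, sorted <%R s -> (forall x, x \in s -> A x) ->
     (forall x y, x \in s -> y \in s -> x < y + e) -> (size s <= L)%N) ->
  finite_set A.
Proof.
move=> e0 A01 H; pose W k := A `&` [set x | Num.trunc (x / e) = k].
have AW : A `<=` \bigcup_(k in `I_(Num.trunc e^-1).+1) W k.
  move=> x Ax; have /andP[x0 x1] := A01 x Ax.
  exists (Num.trunc (x / e)) => //=; rewrite ltnS; apply: le_truncn.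
  by rewrite ler_piMl// invr_ge0 ltW.
apply: sub_finite_set AW _; apply: bigcup_finite; first exact: finite_II.
move=> k _; apply: contrapT => /(infinite_set_fset L.+1)[B BW LB].
have := H (sort <=%O B); rewrite size_sort sort_lt_sorted fset_uniq => /(_ isT) HB.
move: LB; apply/negP; rewrite -leqNgt; apply: HB.
  by move=> x; rewrite mem_sort => /BW[].
move=> x y; rewrite !mem_sort => /BW[/A01/andP[x0 x1] /= xk] /BW[/A01/andP[y0 y1] /= yk].
have /truncn_itv : 0 <= x / e by rewrite divr_ge0// ltW.
have /truncn_itv : 0 <= y / e by rewrite divr_ge0// ltW.
rewrite xk yk -!natr1 => /andP[yk1 _] /andP[_ xk1].
by move: xk1 yk1; rewrite ltr_pdivrMr// ler_pdivlMr// mulrDl mul1r; lra.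
Qed.

End UpIntervals.

(** * Gates *)

Section Gates.
Context {R : realType}.
Implicit Types (f g : R -> R) (a b e p q x y t : R) (m n k l : nat) (r s : bool).

(* Downward gates of [g] are treated as upward gates of [refl g]: a pair
   [(true, a)] stands for the fixed point [1 - a] of [g], left downwards. *)
Definition orient s g := if s then refl g else g.

Definition flip s x : R := if s then 1 - x else x.

Lemma orient_negb s g : orient (~~ s) g = refl (orient s g).
Proof. by case: s => //=; rewrite reflK. Qed.

Lemma orient_refl s g : orient s (refl g) = orient (~~ s) g.
Proof. by case: s => //=; rewrite reflK. Qed.

Lemma flip_refl s x : flip s (1 - x) = flip (~~ s) x.
Proof. by case: s => //=; rewrite subKr. Qed.

Lemma continuous_orient s g : continuous g -> continuous (orient s g).
Proof. by case: s => //=; exact: continuous_refl. Qed.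

Lemma persistent_orient s g : persistent g -> persistent (refl g) -> persistent (orient s g).
Proof. by case: s. Qed.

Lemma unit_valued_orient s g : unit_valued g -> unit_valued (orient s g).
Proof. by case: s => //=; exact: unit_valued_refl. Qed.

Definition upgate g e a := exists q, up_int g a q /\
  exists x n, a < x <= q /\ a + e <= iter n g x.

Lemma upgate_endpoint g e : exists qf, forall s a, upgate (orient s g) e a ->
  up_int (orient s g) a (qf s a) /\
  exists x n, a < x <= qf s a /\ a + e <= iter n (orient s g) x.
Proof.
have H (sa : bool * R) : exists q, upgate (orient sa.1 g) e sa.2 ->
    up_int (orient sa.1 g) sa.2 q /\
    exists x n, sa.2 < x <= q /\ sa.2 + e <= iter n (orient sa.1 g) x.
  case: (pselect (upgate (orient sa.1 g) e sa.2)) => [[q Hq]|N]; last by exists 0.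
  by exists q.
by have [qf qfP] := choice H; exists (fun s a => qf (s, a)) => s a; exact: qfP (s, a).
Qed.

Lemma unit_fixed g a : unit_valued g -> g a = a -> 0 <= a <= 1.
Proof. by move=> g01 <-; exact: g01. Qed.

Lemma up_int_le1 g a q : unit_valued g -> up_int g a q -> q <= 1.
Proof. by move=> g01 [ga aq H]; have := g01 q; have := H q; lra. Qed.

(** Among gates less than [e] apart, an orbit climbing from one to distance [e] passes the next, so
    their intervals form a chain. *)
Lemma upgate_finite g e L : continuous g -> unit_valued g -> persistent g ->
  persistent (refl g) -> 0 < e ->
  (forall l, chain g l -> (l <= L)%N) -> finite_set [set a | upgate g e a].
Proof.
move=> gc g01 gp gp' e0 HL; apply: (@finite_windows _ _ e L) => //.
  by move=> a [q [[ga _ _] _]]; exact: unit_fixed ga.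
move=> s ss sG sw; case: (posnP (size s)) => [->//|s0]; apply: HL.
have [qf qfP] := upgate_endpoint g e.
have G i : (i < size s)%N -> up_int g (nth 0 s i) (qf false (nth 0 s i)) /\
    exists x n, nth 0 s i < x <= qf false (nth 0 s i) /\ nth 0 s i + e <= iter n g x.
  by move=> i_s; apply: (qfP false); apply: sG; exact: mem_nth.
have lt_nth i j : (i < j)%N -> (j < size s)%N -> nth 0 s i < nth 0 s j.
  by move=> ij js; apply: (sorted_ltn_nth lt_trans) => //; rewrite inE//; exact: ltn_trans js.
apply: (@chain_common _ g _ (nth 0 s) (fun i => qf false (nth 0 s i))).
- move=> i i_s; have [U _] := G i i_s; have [ga aq _] := U.
  by have := unit_fixed g01 ga; have := up_int_le1 g01 U; split; lra.
- move=> i j ij js; left; have [U _] := G i (ltn_trans ij js); have [[ga _ _] _] := G j js.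
  exact: up_int_fixed U ga (lt_nth _ _ ij js).
- have s1 : ((size s).-1 < size s)%N by rewrite prednK.
  have [[ga aq H] _] := G _ s1; exists (qf false (nth 0 s (size s).-1)).
    by rewrite /seg /=; lra.
  by apply: persistent_nonrecurrent_up => //; apply: H; lra.
- move=> i i_s; have [U [x [n [ax aen]]]] := G i i_s.
  case: (ltnP i.+1 (size s)) => [i1s|_]; last first.
    by exists 1%N; split=> //; exact: up_int_self.
  have [U' _] := G _ i1s.
  have near : nth 0 s i.+1 < nth 0 s i + e by apply: sw; exact: mem_nth.
  have [||k k0 ck] := @up_cover_up _ g _ _ _ _ x n gc U U' (lt_nth _ _ (ltnSn i) i1s); try lra.
  exists k; split=> //.
  by have := cov_mul k (up_int_self gc U); rewrite muln1.
Qed.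

Lemma common_scale (T : eqType) (s : seq T) (P : T -> R -> Prop) :
  (forall z, z \in s -> exists2 t, 0 < t & P z t) ->
  (forall z t t', 0 < t' -> t' <= t -> P z t -> P z t') ->
  exists2 t, 0 < t & forall z, z \in s -> P z t.
Proof.
move=> H anti; elim: s H => [|z s IH] H; first by exists 1.
have [|t t0 Ht] := IH; first by move=> y ys; apply: H; rewrite inE ys orbT.
have [t' t'0 Ht'] := H z (mem_head _ _).
have m0 : 0 < Num.min t t' by rewrite lt_min t0.
exists (Num.min t t') => // y; rewrite inE => /predU1P[->|/Ht].
  by apply: anti Ht' => //; rewrite ge_min lexx orbT.
by apply: anti => //; rewrite ge_min lexx.
Qed.

Definition fine_scale g e (qf : bool -> R -> R) t :=
  [/\ 0 < t, t <= e,
      forall s a, upgate (orient s g) e a ->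
        [/\ up_int (orient s g) a (qf s a), a + t <= qf s a &
            forall x, a < x < a + t -> orient s g x <= qf s a] &
      forall s a b, upgate (orient s g) e a -> upgate (orient (~~ s) g) e b -> a < 1 - b ->
        (exists2 k, (0 < k)%N &
           cov (orient s g) k (seg a (qf s a)) (seg (1 - qf (~~ s) b) (1 - b))) \/
        (forall x n, a <= x <= qf s a -> iter n (orient s g) x <= 1 - b - t)].

(** There are finitely many gates, so the thresholds given by continuity and by [up_cover_down] have
    a positive minimum. *)
Lemma fine_scale_exists g e L : continuous g -> unit_valued g -> persistent g ->
  persistent (refl g) -> 0 < e ->
  (forall l, chain g l -> (l <= L)%N) -> exists qf t, fine_scale g e qf t.
Proof.
move=> gc g01 gp gp' e0 HL; have [qf qfP] := upgate_endpoint g e; exists qf.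
have fin s : finite_set [set a | upgate (orient s g) e a].
  apply: (@upgate_finite _ _ L) => //.
  - exact: continuous_orient.
  - exact: unit_valued_orient.
  - exact: persistent_orient.
  - by rewrite -orient_negb; exact: persistent_orient.
  - by case: s => //= l /chain_refl; exact: HL.
have /finite_seqP[s0 E0] := fin false; have /finite_seqP[s1 E1] := fin true.
pose S s := if s then s1 else s0.
have E s : [set a | upgate (orient s g) e a] = [set` S s] by case: s.
have memS s a : upgate (orient s g) e a -> a \in S s.
  by move=> G; have : [set a | upgate (orient s g) e a] a by []; rewrite E.
have memSP s a : a \in S s -> upgate (orient s g) e a.
  by move=> aS; have : [set` S s] a by []; rewrite -E.
have own s : exists2 t, 0 < t & forall a, a \in S s -> a + t <= qf s a /\
    forall x, a < x < a + t -> orient s g x <= qf s a.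
  apply: common_scale => [a /memSP/qfP[[ga aq _] _]|a t t' t0 tt' [t1 t2]]; last first.
    by split=> [|x xa]; [lra|apply: t2; lra].
  have [|d d0 H] := @cont_delta _ _ a (qf s a - a) (@continuous_orient s g gc); first lra.
  exists (Num.min d (qf s a - a)); first by rewrite lt_min d0; lra.
  have m1 : Num.min d (qf s a - a) <= d by rewrite ge_min lexx.
  have m2 : Num.min d (qf s a - a) <= qf s a - a by rewrite ge_min lexx orbT.
  by split=> [|x xa]; [lra|have := H x; lra].
have opp s : exists2 t, 0 < t & forall ab, ab \in [seq (a, b) | a <- S s, b <- S (~~ s)] ->
    ab.1 < 1 - ab.2 ->
    (exists2 k, (0 < k)%N & cov (orient s g) k (seg ab.1 (qf s ab.1))
       (seg (1 - qf (~~ s) ab.2) (1 - ab.2))) \/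
    (forall x n, ab.1 <= x <= qf s ab.1 -> iter n (orient s g) x <= 1 - ab.2 - t).
  apply: common_scale => [ab|ab t t' t'0 tt' H /H[?|{}H]]; last 2 first.
  - by left.
  - by right=> x n /(H x n); lra.
  move=> /allpairsP[[a b] /= [/memSP/qfP[U _] /memSP/qfP[[gb bq Hb] _] ->]] /=.
  have [ba|ab'] := leP (1 - b) a; first by exists 1 => //; lra.
  have gE x : orient (~~ s) g x = 1 - orient s g (1 - x) by rewrite orient_negb.
  have := @up_cover_down _ (orient s g) a (qf s a) (1 - b) (1 - qf (~~ s) b)
    (@continuous_orient s g gc) (@persistent_orient s g gp gp') U _ _ _ ab'.
  case; [by move: gb; rewrite gE; lra|lra| |].
    by move=> x xb; have := Hb (1 - x); rewrite gE subKr; lra.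
  move=> _ [ck|[t t0 Ht]]; first by exists 1 => // _; left.
  by exists t => // _; right.
have [t0 t00 P0] := own false; have [t1 t10 P1] := own true.
have [t2 t20 P2] := opp false; have [t3 t30 P3] := opp true.
pose t := Num.min e (Num.min (Num.min t0 t1) (Num.min t2 t3)).
have tpos : 0 < t by rewrite !lt_min e0 t00 t10 t20 t30.
have te : t <= e by rewrite ge_min lexx.
have tt0 : t <= t0 by rewrite !ge_min lexx ?orbT.
have tt1 : t <= t1 by rewrite !ge_min lexx ?orbT.
have tt2 : t <= t2 by rewrite !ge_min lexx ?orbT.
have tt3 : t <= t3 by rewrite !ge_min lexx ?orbT.
exists t; split=> //.
- move=> s a G; have [U _] := qfP s a G; have aS := memS s a G.
  have [K1 K2] : a + t <= qf s a /\ (forall x, a < x < a + t -> orient s g x <= qf s a).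
    case: s {G U} aS => aS; [have [k1 k2] := P1 a aS|have [k1 k2] := P0 a aS];
      by split=> [|x xa]; [lra|apply: k2; lra].
  by split.
- move=> s a b G G' ab; have inS : (a, b) \in [seq (a, b) | a <- S s, b <- S (~~ s)].
    by apply: allpairs_f; exact: memS.
  case: s {G G'} inS => inS.
    have [ck|H] := P3 _ inS ab; [by left|right=> x n /(H x n) /=; lra].
  have [ck|H] := P2 _ inS ab; [by left|right=> x n /(H x n) /=; lra].
Qed.

(** At a fine scale points just beyond a gate move away from it, so leaving [(a, a + t)] means
    passing [a + t]. *)
Definition at_exit g e t x := exists s a, [/\ upgate (orient s g) e a,
  a < flip s x < a + t & ~~ (a < flip s (g x) < a + t)].

Lemma at_exit_refl g e t x : at_exit (refl g) e t (1 - x) -> at_exit g e t x.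
Proof.
move=> [s [a]]; rewrite orient_refl /refl !subKr !flip_refl => H.
by exists (~~ s), a.
Qed.

Lemma fine_scale_refl g e qf t : fine_scale g e qf t ->
  fine_scale (refl g) e (fun s => qf (~~ s)) t.
Proof.
move=> [t0 te F1 F2]; split=> // [s a|s a b]; first by rewrite orient_refl; exact: F1.
by rewrite !orient_refl; exact: F2.
Qed.

(** The endpoints of a gate interval in the original coordinate, whatever the orientation. *)
Definition gate_lo s a q : R := if s then 1 - q else a.
Definition gate_hi s a q : R := if s then 1 - a else q.

(** After the exit the orbit is beyond [a + t] but still at a rising point of the gate interval, so
    persistence keeps it beyond [a + t]. Hence any gate left later is another one, further up. *)
Lemma exit_pair_up g e qf t a r b x k : continuous g -> persistent g -> persistent (refl g) ->
  fine_scale g e qf t -> upgate g e a -> a < x < a + t -> ~~ (a < g x < a + t) ->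
  upgate (orient r g) e b -> b < flip r (iter k.+1 g x) < b + t ->
  qf false a < gate_lo r b (qf r b) /\
  exists2 m, (0 < m)%N &
    cov g m (seg a (qf false a)) (seg (gate_lo r b (qf r b)) (gate_hi r b (qf r b))).
Proof.
move=> gc gp gp' [t0 te F1 F2] Ga xa gxa Gb yb.
have [U aq gq] := F1 false a Ga; have [ga _ H] := U; rewrite /= in ga H.
have xU : x < g x by apply: H; lra.
have gxt : a + t <= g x by move: gxa; lra.
have gx1 : g x < g (g x) by apply: H; have := gq x xa; rewrite /=; lra.
have ya : a + t <= iter k.+1 g x.
  by rewrite iterSr; apply: (le_trans gxt); apply: persistent_ge => //; exact: ltW.
have [y yE] : exists y, iter k.+1 g x = y by exists (iter k.+1 g x).
rewrite yE in yb ya.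
case: r => /= in Gb yb *; last first.
  have [U' bq _] := F1 false b Gb; have [gb _ Hb] := U'; rewrite /= in gb Hb.
  (* If [b] were to the left of [a], the fixed point [a] would lie in the rising interval of [b]. *)
  have ab : a < b.
    rewrite ltNge le_eqVlt; apply/negP => /predU1P[ba|ba]; first by move: yb; rewrite ba; lra.
    by have := Hb a; rewrite ga; lra.
  split; first exact: up_int_fixed U gb ab.
  have yb' : b < iter k.+1 g x by rewrite yE; lra.
  have xq : a <= x <= qf false a by lra.
  exact: (up_cover_up gc U U' ab xq yb').
have [U' bq _] := F1 true b Gb; have [gb _ Hb] := U'; rewrite /= /refl in gb Hb.
have ab : a < 1 - b by lra.
have [_ _ Ha] := U.
split; last first.
  (* The orbit comes [t]-close to [1 - b], which excludes the second alternative. *)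
  case: (F2 false a b Ga Gb ab) => [//|/(_ x k.+1)]; rewrite [iter _ _ _]yE /=; lra.
have [|||//] := @up_cover_down _ g a (qf false a) (1 - b) (1 - qf true b) gc gp U _ _ _ ab; try lra.
by move=> z zb; have := Hb (1 - z); rewrite subKr; lra.
Qed.

Lemma exit_pair g e qf t s a r b x k : continuous g -> persistent g -> persistent (refl g) ->
  fine_scale g e qf t -> upgate (orient s g) e a ->
  a < flip s x < a + t -> ~~ (a < flip s (g x) < a + t) ->
  upgate (orient r g) e b -> b < flip r (iter k.+1 g x) < b + t ->
  (gate_hi s a (qf s a) < gate_lo r b (qf r b) \/ gate_hi r b (qf r b) < gate_lo s a (qf s a)) /\
  exists2 m, (0 < m)%N & cov g m (seg (gate_lo s a (qf s a)) (gate_hi s a (qf s a)))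
    (seg (gate_lo r b (qf r b)) (gate_hi r b (qf r b))).
Proof.
move=> gc gp gp' F Ga xa gxa Gb yb; case: s => /= in Ga xa gxa *; last first.
  by have [H [m m0 cm]] := exit_pair_up gc gp gp' F Ga xa gxa Gb yb; split; [left|exists m].
have := @exit_pair_up (refl g) e (fun s => qf (~~ s)) t a (~~ r) b (1 - x) k
  (continuous_refl gc) gp' _ (fine_scale_refl F) Ga xa _ _ _.
rewrite reflK orient_refl negbK iter_refl subKr flip_refl negbK => /(_ gp _ Gb yb).
rewrite /refl subKr => /(_ gxa) [H [m m0 cm]].
have lohi : 1 - gate_hi (~~ r) b (qf r b) = gate_lo r b (qf r b) /\
    1 - gate_lo (~~ r) b (qf r b) = gate_hi r b (qf r b).
  by case: r {Gb yb H cm} => /=; rewrite ?subKr.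
case: lohi => e1 e2; split; first by right; rewrite -e2; lra.
by exists m => //; rewrite -e1 -e2; exact: cov_refl.
Qed.

(** The gates left at successive exits have disjoint intervals, each covering the next. This bounds
    the number of exits of an orbit by the largest order of a chain. *)
Lemma exits_chain g e qf t x (ts : seq nat) : continuous g -> unit_valued g ->
  persistent g -> persistent (refl g) -> fine_scale g e qf t -> (0 < size ts)%N ->
  sorted ltn ts -> (forall i, i \in ts -> at_exit g e t (iter i g x)) -> chain g (size ts).
Proof.
move=> gc g01 gp gp' F s0 tss tsE.
have H i : exists sa : bool * R, (i < size ts)%N -> [/\ upgate (orient sa.1 g) e sa.2,
    sa.2 < flip sa.1 (iter (nth 0%N ts i) g x) < sa.2 + t &
    ~~ (sa.2 < flip sa.1 (g (iter (nth 0%N ts i) g x)) < sa.2 + t)].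
  case: (ltnP i (size ts)) => [i_s|_]; last by exists (false, 0).
  by have [s [a Hsa]] := tsE _ (mem_nth 0%N i_s); exists (s, a).
have {H}[G GP] := choice H.
pose lo i := gate_lo (G i).1 (G i).2 (qf (G i).1 (G i).2).
pose hi i := gate_hi (G i).1 (G i).2 (qf (G i).1 (G i).2).
have [t0 te F1 F2] := F.
have Gup i : (i < size ts)%N -> up_int (orient (G i).1 g) (G i).2 (qf (G i).1 (G i).2).
  by move=> i_s; have [Gi _ _] := GP i i_s; case: (F1 _ _ Gi).
have pair i j : (i < j)%N -> (j < size ts)%N -> (hi i < lo j \/ hi j < lo i) /\
    exists2 m, (0 < m)%N & cov g m (seg (lo i) (hi i)) (seg (lo j) (hi j)).
  move=> ij js; have [Gi Ni Ei] := GP i (ltn_trans ij js); have [Gj Nj _] := GP j js.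
  have tij : (nth 0 ts i < nth 0 ts j)%N.
    by apply: (sorted_ltn_nth ltn_trans) => //; rewrite inE//; exact: ltn_trans js.
  apply: (@exit_pair _ _ _ _ _ _ _ _ _ (nth 0 ts j - nth 0 ts i).-1%N gc gp gp' F Gi Ni Ei Gj).
  by rewrite prednK ?subn_gt0// -iterD subnK// ltnW.
have bounds i : (i < size ts)%N -> [/\ 0 <= lo i, lo i < hi i & hi i <= 1].
  move=> i_s; have U := Gup i i_s; have [ga aq _] := U.
  have g01' := @unit_valued_orient (G i).1 g g01.
  have := unit_fixed g01' ga; have := up_int_le1 g01' U; move: aq.
  by rewrite /lo /hi /gate_lo /gate_hi; case: (G i).1; split; lra.
have selfcov i : (i < size ts)%N -> cov g 1 (seg (lo i) (hi i)) (seg (lo i) (hi i)).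
  move=> i_s; have := up_int_self (@continuous_orient (G i).1 g gc) (Gup i i_s).
  by rewrite /lo /hi /gate_lo /gate_hi; case: (G i).1 => //= /cov_refl.
apply: (@chain_common _ g _ lo hi).
- by move=> i /bounds[]; split=> //; exact: ltW.
- by move=> i j ij js; exact: (pair i j ij js).1.
- have s1 : ((size ts).-1 < size ts)%N by rewrite prednK.
  have [ga aq H] := Gup _ s1; have := H (qf (G (size ts).-1).1 (G (size ts).-1).2).
  rewrite aq lexx => /(_ isT) qU; have [_ lohi _] := bounds _ s1.
  (* The far endpoint of the last gate interval is not fixed, hence not recurrent. *)
  exists (flip (G (size ts).-1).1 (qf (G (size ts).-1).1 (G (size ts).-1).2)).
    move: lohi; rewrite /seg /lo /hi /flip /gate_lo /gate_hi /=.
    by case: (G _).1 => ?; rewrite lexx ltW.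
  apply: persistent_nonrecurrent => //; apply/negP => /eqP.
  by move: qU; rewrite /flip; case: (G _).1 => /=; rewrite /refl; lra.
- move=> i i_s; have sc m := cov_mul m (selfcov i i_s).
  case: (ltnP i.+1 (size ts)) => [i1s|_]; last by exists 1%N; split=> //; exact: selfcov.
  have [_ [m m0 cm]] := pair i i.+1 (ltnSn i) i1s.
  by exists m; split=> //; have := sc m; rewrite muln1.
Qed.

End Gates.

(** * Orbits between exits *)

Section Cells.
Context {R : realType}.
Implicit Types (f g : R -> R) (a b e p q x y t : R) (m n k l : nat).

Lemma first_change (P : pred nat) n : P 0%N -> ~~ P n ->
  exists2 j, (j < n)%N & P j && ~~ P j.+1.
Proof.
elim: n => [->//|n IH] P0 Pn; have [Pn'|/IH[//|j jn Pj]] := boolP (P n).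
  by exists n; rewrite ?Pn'.
by exists j => //; exact: ltnW.
Qed.

Definition no_exit g e t n x := forall j, (j < n)%N -> ~ at_exit g e t (iter j g x).

Lemma no_exit_shift g e t n m x : (m <= n)%N -> no_exit g e t n x ->
  no_exit g e t (n - m) (iter m g x).
Proof. by move=> mn H j jn; rewrite -iterD; apply: H; lia. Qed.

Lemma no_exit_refl g e t n x : no_exit g e t n x -> no_exit (refl g) e t n (1 - x).
Proof.
by move=> H j jn; rewrite iter_refl subKr => /at_exit_refl; exact: H.
Qed.

(** If the orbit of [x] reaches [p + 2e], then [x] rises and the last fixed point [a < x] is a gate,
    as [a + e <= p + 2e]. By the choice of [d] this gate is [p] itself, and the orbit has left
    [(p, p + t)] through an exit. *)
Lemma local_right g e qf t p : continuous g -> persistent g -> persistent (refl g) ->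
  0 < e -> fine_scale g e qf t -> finite_set [set a | upgate g e a] -> g p = p ->
  exists2 d, 0 < d & forall x n, p < x < p + d -> no_exit g e t n x -> iter n g x < p + 2 * e.
Proof.
move=> gc gp gp' e0 [t0 te F1 _] /finite_seqP[s sE] pf.
(* No gate lies strictly between [p] and [p + d]. *)
have [||d d0 Hd] := @common_scale _ _ s (fun a d => a <= p \/ p + d <= a).
- move=> a _; have [ap|pa] := leP a p; first by exists 1 => //; left.
  by exists (a - p); [lra|right; lra].
- by move=> a d d' d'0 dd' [?|?]; [left|right; lra].
exists (Num.min d t); first by rewrite lt_min d0.
have m1 : Num.min d t <= d by rewrite ge_min lexx.
have m2 : Num.min d t <= t by rewrite ge_min lexx orbT.
move=> x n xp H; rewrite ltNge; apply/negP => far.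
have xU : x < g x.
  rewrite ltNge; apply/negP; rewrite le_eqVlt => /predU1P[xf|xD].
    by move: far; rewrite iter_fixed //; lra.
  case: n far {H} => [/=|n far]; first by lra.
  by have := persistent_lt_down n gp' xD; lra.
have [||a [/andP[pa ax] ga aU]] := @last_fix _ g x p gc _ xU; try lra.
have Ga : upgate g e a.
  by exists x; split; [split=> // y; exact: aU|exists x, n; split; lra].
have as_ : a \in s by have : [set a | upgate g e a] a by []; rewrite sE.
have {}pa : a = p by have := Hd a as_; lra.
have [_ aq _] := F1 false a Ga; rewrite pa in aq Ga.
have [||j jn /andP[N1 N2]] := @first_change (fun j => p < iter j g x < p + t) n.
- by rewrite /=; lra.
- by apply/negP; lra.
by apply: (H j jn); exists false, p.
Qed.

(** A point to the left of [p] that ever passes [p] does not fall, so its orbit stays close to [p]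
    until it first crosses. By continuity it lands in the range of [local_right]. *)
Lemma local_up g e qf t p : continuous g -> persistent g -> persistent (refl g) ->
  0 < e -> fine_scale g e qf t -> finite_set [set a | upgate g e a] -> g p = p ->
  exists2 d, 0 < d & forall x n, p - d < x < p + d -> no_exit g e t n x ->
    iter n g x < p + 2 * e.
Proof.
move=> gc gp gp' e0 F fin pf; have [d d0 Hd] := local_right gc gp gp' e0 F fin pf.
have [d' d'0 Hd'] := cont_delta p gc d0.
exists (Num.min d d'); first by rewrite lt_min d0.
have m1 : Num.min d d' <= d by rewrite ge_min lexx.
have m2 : Num.min d d' <= d' by rewrite ge_min lexx orbT.
move=> x n xp H; have [px|xp'] := ltP p x; first by apply: Hd => //; lra.
have [nle|ngt] := leP (iter n g x) p; first by lra.
have [||j jn /andP[N1 N2]] := @first_change (fun j => iter j g x <= p) n => //.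
  by rewrite -ltNge.
have xU : x <= g x.
  rewrite leNgt; apply/negP => xD; case: n ngt {H} jn => // n ngt _.
  by have := persistent_lt_down n gp' xD; lra.
have xj : x <= iter j g x by exact: persistent_ge.
have := Hd' (iter j g x); rewrite pf -iterS => Hj.
rewrite -(subnK jn) iterD; apply: Hd; last exact: no_exit_shift.
by rewrite -ltNge in N2; lra.
Qed.

Lemma local_stay g e qf t p : continuous g -> persistent g -> persistent (refl g) ->
  0 < e -> fine_scale g e qf t -> (forall s, finite_set [set a | upgate (orient s g) e a]) ->
  g p = p ->
  exists2 d, 0 < d & forall x n, p - d < x < p + d -> no_exit g e t n x ->
    p - 2 * e < iter n g x < p + 2 * e.
Proof.
move=> gc gp gp' e0 F fin pf; have [d d0 Hd] := local_up gc gp gp' e0 F (fin false) pf.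
have [||d' d'0 Hd'] := @local_up (refl g) e _ t (1 - p) (continuous_refl gc) gp' _ e0
  (fine_scale_refl F) (fin true) _.
- by rewrite reflK.
- by rewrite /refl subKr pf.
exists (Num.min d d'); first by rewrite lt_min d0.
have m1 : Num.min d d' <= d by rewrite ge_min lexx.
have m2 : Num.min d d' <= d' by rewrite ge_min lexx orbT.
move=> x n xp H; have := Hd x n _ H; have := Hd' (1 - x) n _ (no_exit_refl H).
by rewrite iter_refl subKr => K1 K2; apply/andP; split; [have := K1; lra|apply: K2; lra].
Qed.

(** An orbit avoiding all these neighbourhoods stays in a compact set without fixed points. There
    [g] and [g^2] displace points by at least some [c > 0], and persistence then makes the orbit
    arbitrarily wide. *)
Lemma orbit_visits g (d : R -> R) x : continuous g -> unit_valued g ->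
  persistent g -> persistent (refl g) -> (forall p, g p = p -> 0 < d p) ->
  0 <= x <= 1 -> exists n p, g p = p /\ p - d p < iter n g x < p + d p.
Proof.
move=> gc g01 gp gp' dP x01; apply: contrapT => noV.
pose K := `[0, 1]%classic `&` ~` \bigcup_(p in [set p | g p = p]) `](p - d p), (p + d p)[%classic.
have Kc : compact K.
  suff Kcl : closed K by exact: (subclosed_compact Kcl (@segment_compact R 0 1) (@subIsetl _ _ _)).
  apply: closedI; first exact: interval_closed.
  by apply: open_closedC; apply: bigcup_open => p _; exact: interval_open.
have Kf y : K y -> g y != y.
  move=> [_ Ky]; apply/eqP => yf; apply: Ky; exists y => //=.
  by rewrite in_itv /=; have := dP y yf; lra.
have Kx n : K (iter n g x).
  split; first by rewrite /= in_itv /=; case: n => [//|n]; rewrite iterS g01.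
  by move=> [p /= pf]; rewrite in_itv /= => np; apply: noV; exists n, p.
have normc (h : R -> R) : continuous h -> continuous (fun y => `|h y - y|).
  by move=> hc y; apply: cvg_norm; apply: cvgB; [exact: hc|exact: cvg_id].
have [d1 d10 H1] := pos_min_compact (normc g gc) Kc
  (fun y Ky => etrans (normr_gt0 _) (etrans (congr1 negb (subr_eq0 _ _)) (Kf y Ky))).
have [y Ky|d2 d20 H2] := pos_min_compact (normc (iter 2 g) (continuous_iter (n := 2) gc)) Kc.
  rewrite normr_gt0 subr_eq0; have := Kf y Ky; rewrite neq_lt => /orP[yD|yU].
    by rewrite lt_eqF// persistent_lt_down.
  by rewrite gt_eqF// gp.
pose c := Num.min d1 d2; have c0 : 0 < c by rewrite lt_min d10.
have c1 : c <= d1 by rewrite ge_min lexx.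
have c2 : c <= d2 by rewrite ge_min lexx orbT.
have jump i k : (0 < k <= 2)%N -> c <= `|iter (i + k) g x - iter i g x|.
  case: k => [//|[|[|//]]] _; first by have := H1 _ (Kx i); rewrite addn1 iterS; lra.
  by have := H2 _ (Kx i); rewrite -iterD addnC; lra.
have width k i a b : (forall j, a <= iter (i + j) g x <= b) -> c *+ k <= b - a.
  elim: k i a b => [|k IH] i a b ab; first by have := ab 0%N; rewrite mulr0n; lra.
  (* Two moves in the same direction at times [u < v <= u + 2]: from [v] on the orbit stays beyond
     its position at [v], which is [c] further than at [u]. The remaining range is thus narrower by
     [c]. *)
  have same u v : (u < v <= u + 2)%N -> (i <= u)%N ->
      (iter u g x < iter u.+1 g x) = (iter v g x < iter v.+1 g x) -> c *+ k.+1 <= b - a.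
    move=> /andP[uv vu] iu E; have := jump u (v - u)%N; rewrite subnKC ?(ltnW uv)// => /(_ _).
    rewrite subn_gt0 uv leq_subLR vu => /(_ isT) Juv.
    have [i' ui'] : exists i', u = (i + i')%N by exists (u - i)%N; lia.
    have [v' vv'] : exists v', v = (i + v')%N by exists (v - i)%N; lia.
    have [m vm] : exists m, v = (m.+1 + u)%N by exists (v - u).-1; lia.
    have auv := ab i'; have bv := ab v'; rewrite -ui' in auv; rewrite -vv' in bv.
    case: (ltP (iter u g x) (iter u.+1 g x)) E => uU /esym E.
      have uv' : iter u g x < iter v g x by rewrite vm iterD; exact: gp.
      have := IH v (iter v g x) b; rewrite mulrS.
      move: Juv; rewrite gtr0_norm ?subr_gt0// => Juv K1.
      suff : c *+ k <= b - iter v g x by lra.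
      apply: K1 => j; have := ab (v' + j)%N; rewrite addnA -vv' => /andP[_ ->]; rewrite andbT.
      by rewrite addnC iterD; apply: persistent_ge => //; apply/ltW; rewrite -iterS E.
    have uD : iter u.+1 g x < iter u g x.
      by rewrite lt_neqAle uU andbT iterS Kf.
    have uv' : iter v g x < iter u g x.
      by rewrite vm iterD; apply: persistent_lt_down.
    have vD : iter v.+1 g x < iter v g x.
      by rewrite lt_neqAle leNgt E andbT iterS Kf.
    have := IH v a (iter v g x); rewrite mulrS.
    move: Juv; rewrite ltr0_norm ?subr_lt0// => Juv K1.
    suff : c *+ k <= iter v g x - a by lra.
    apply: K1 => j; have := ab (v' + j)%N; rewrite addnA -vv' => /andP[-> _] /=.
    rewrite addnC iterD; case: j => [//|j]; exact/ltW/persistent_lt_down.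
  (* Among three consecutive moves two have the same direction. *)
  case: (boolP ((iter i g x < iter i.+1 g x) == (iter i.+1 g x < iter i.+2 g x))) => [/eqP|n1].
    by apply: same; lia.
  case: (boolP ((iter i.+1 g x < iter i.+2 g x) == (iter i.+2 g x < iter i.+3 g x))) => [/eqP|n2].
    by apply: same; lia.
  apply: (same i i.+2); [lia|lia|].
  by move: n1 n2; do 3 case: (_ < _).
have := width (Num.bound c^-1) 0%N 0 1; rewrite subr0 => W.
have : c^-1 < (Num.bound c^-1)%:R by apply: archi_boundP; rewrite invr_ge0 ltW.
have {}W : c *+ Num.bound c^-1 <= 1.
  by apply: W => j; have [] := Kx (0 + j)%N; rewrite /= in_itv.
by rewrite -[X in X < _]mulr1 ltr_pdivrMl// mulr_natr ltNge W.
Qed.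

Lemma iter_delta g x e n : continuous g -> 0 < e ->
  exists2 d, 0 < d & forall y i, (i <= n)%N -> x - d < y < x + d ->
    iter i g x - e < iter i g y < iter i g x + e.
Proof.
move=> gc e0; elim: n => [|n [d d0 H]].
  by exists e => // y i; rewrite leqn0 => /eqP ->.
have [d' d'0 H'] := cont_delta x (continuous_iter (n := n.+1) gc) e0.
exists (Num.min d d'); first by rewrite lt_min d0.
have m1 : Num.min d d' <= d by rewrite ge_min lexx.
have m2 : Num.min d d' <= d' by rewrite ge_min lexx orbT.
move=> y i; rewrite leq_eqVlt => /predU1P[->|i_n] yx; first by apply: H'; lra.
by apply: H => //; lra.
Qed.

(** Every [z] comes close to a fixed point [p] at some time [T]. Points near [z] follow it until [T]
    and then remain within [2e] of [p]; compactness leaves finitely many such neighbourhoods. *)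
Lemma cells g e qf t : continuous g -> unit_valued g -> persistent g -> persistent (refl g) ->
  0 < e -> fine_scale g e qf t -> (forall s, finite_set [set a | upgate (orient s g) e a]) ->
  exists K (c : R -> 'I_K.+1), forall x y n, 0 <= x <= 1 -> 0 <= y <= 1 -> c x = c y ->
    no_exit g e t n x -> no_exit g e t n y -> `|iter n g x - iter n g y| <= 4 * e.
Proof.
move=> gc g01 gp gp' e0 F fin.
have stay p : exists d, g p = p -> 0 < d /\ forall x n, p - d < x < p + d ->
    no_exit g e t n x -> p - 2 * e < iter n g x < p + 2 * e.
  case: (pselect (g p = p)) => [pf|]; last by exists 0.
  by have [d d0 Hd] := local_stay gc gp gp' e0 F fin pf; exists d.
have {stay}[d dP] := choice stay.
have nbd z : exists r, 0 <= z <= 1 -> 0 < r /\ forall x y n,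
    z - r < x < z + r -> z - r < y < z + r ->
    no_exit g e t n x -> no_exit g e t n y -> `|iter n g x - iter n g y| <= 4 * e.
  case: (boolP (0 <= z <= 1)) => [z01|]; last by exists 0.
  have [T [p [pf zT]]] := orbit_visits gc g01 gp gp' (fun p pf => (dP p pf).1) z01.
  have [_ dp] := dP p pf.
  (* Closeness [e'] at time [T] also guarantees arrival in the neighbourhood of [p]. *)
  pose e' := Num.min e (Num.min (iter T g z - (p - d p)) (p + d p - iter T g z)).
  have e'0 : 0 < e' by rewrite !lt_min e0; apply/andP; split; lra.
  have e1 : e' <= e by rewrite ge_min lexx.
  have e2 : e' <= iter T g z - (p - d p) by rewrite !ge_min lexx orbT.
  have e3 : e' <= p + d p - iter T g z by rewrite !ge_min lexx !orbT.
  have [r r0 Hr] := iter_delta z T gc e'0.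
  exists r => _; split=> // x y n xz yz Nx Ny; rewrite ler_norml.
  have [nT|Tn] := leqP n T; first by have := Hr x n nT xz; have := Hr y n nT yz; lra.
  have near w : z - r < w < z + r -> no_exit g e t n w -> p - 2 * e < iter n g w < p + 2 * e.
    move=> wz Nw; rewrite -(subnK (ltnW Tn)) iterD; apply: dp.
      by have := Hr w T (leqnn T) wz; lra.
    exact: no_exit_shift (ltnW Tn) Nw.
  by have := near x xz Nx; have := near y yz Ny; lra.
have [r rP] := choice nbd.
have := @segment_compact R 0 1; rewrite compact_cover.
move=> /(_ _ `[0, 1]%classic (fun z => `](z - r z), (z + r z)[%classic)).
case; [by move=> z _; exact: interval_open| |].
  move=> z z01; exists z => //=; rewrite in_itv /=; rewrite /= in_itv /= in z01.
  by have [] := rP z z01; lra.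
move=> D Dsub Dcov; pose s := enum_fset D.
pose inb x z := z - r z < x < z + r z.
(* The cell of [x] is the index of the first neighbourhood of the subcover that contains it. *)
exists (size s), (fun x => inord (find (inb x) s)) => x y n x01 y01 cxy.
have hasb w : 0 <= w <= 1 -> has (inb w) s.
  move=> w01; have [|z /= zD] := Dcov w; first by rewrite /= in_itv.
  by rewrite in_itv /= => wz; apply/hasP; exists z.
have fxy : find (inb x) s = find (inb y) s.
  by have := congr1 val cxy; rewrite /= !inordK ?ltnS ?find_size.
have zs : nth 0 s (find (inb x) s) \in s by rewrite mem_nth// -has_find hasb.
have z01 : 0 <= nth 0 s (find (inb x) s) <= 1.
  by have := Dsub _ zs; rewrite inE /= in_itv.
have [_ H] := rP _ z01.
apply: H; first exact: (nth_find 0 (hasb x x01)).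
by rewrite fxy; exact: (nth_find 0 (hasb y y01)).
Qed.

End Cells.

(** * Polynomial bound on separated sets *)

Section Counting.
Context {R : realType}.
Implicit Types (f g : R -> R) (e t x y : R) (m n k l : nat).

Lemma bowen_le n g x y e : 0 <= e ->
  (forall i, (i < n)%N -> `|iter i g x - iter i g y| <= e) -> bowen_dist n g x y <= e.
Proof. by move=> e0 H; apply: bigmax_le => // i _; exact: H. Qed.

Lemma bowen_ge n g x y i : (i < n)%N -> `|iter i g x - iter i g y| <= bowen_dist n g x y.
Proof.
move=> i_n; rewrite /bowen_dist.
exact: (le_bigmax _ (fun i : 'I_n => `|iter i g x - iter i g y|) (Ordinal i_n)).
Qed.

(** The default value 0 acts as padding: it does not occur in the lists, so the first [L] entries
    also determine the length. *)
Lemma eq_nth_padded (s s' : seq nat) L : (size s <= L)%N -> (size s' <= L)%N ->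
  0%N \notin s -> 0%N \notin s' ->
  (forall i, (i < L)%N -> nth 0%N s i = nth 0%N s' i) -> s = s'.
Proof.
have half u u' : (size u' <= L)%N -> 0%N \notin u' ->
    (forall i, (i < L)%N -> nth 0%N u i = nth 0%N u' i) -> (size u' <= size u)%N.
  move=> u'L u'0 H; rewrite leqNgt; apply/negP => uu'.
  have := H (size u) (leq_trans uu' u'L); rewrite nth_default// => E.
  by move: u'0; rewrite E mem_nth.
move=> sL s'L s0 s'0 H; have ss' : size s = size s'.
  by apply/eqP; rewrite eqn_leq !half// => i /H.
by apply: (eq_from_nth (x0 := 0%N)) ss' _ => i i_s; apply: H; exact: leq_trans sL.
Qed.

(** A point is encoded by its cell, its at most [L] exit times, and the cells occupied just after
    the exits. Points with equal codes remain [4e]-close, so the code is injective on a separated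
    set. *)
Lemma sep_count_persistent g L e : continuous g -> unit_valued g -> persistent g ->
  persistent (refl g) -> (forall l, chain g l -> (l <= L)%N) -> 0 < e ->
  exists C, forall n (S : {fset R}), [set` S] `<=` unitI ->
    bowen_separated n (4 * e) g [set` S] -> (#|` S| <= C * n.+1 ^ L)%N.
Proof.
move=> gc g01 gp gp' HL e0; have [qf [t F]] := fine_scale_exists gc g01 gp gp' e0 HL.
have fin s : finite_set [set a | upgate (orient s g) e a].
  apply: (@upgate_finite _ _ _ L) => //.
  - exact: continuous_orient.
  - exact: unit_valued_orient.
  - exact: persistent_orient.
  - by rewrite -orient_negb; exact: persistent_orient.
  - by case: s => //= l /chain_refl; exact: HL.
have [K [c cP]] := cells gc g01 gp gp' e0 F fin.
exists (K.+1 * K.+1 ^ L)%N => n S S01 Ssep.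
pose ts x := [seq j <- iota 0 n | `[< at_exit g e t (iter j g x) >]].
(* Exit times are shifted to the instant after the exit, which frees 0 for padding. *)
pose es x := map succn (ts x).
have esL x : (size (es x) <= L)%N.
  rewrite size_map; case: (posnP (size (ts x))) => [->//|s0]; apply: HL.
  apply: (exits_chain (x := x) gc g01 gp gp' F s0).
    by apply: sorted_filter; [exact: ltn_trans|exact: iota_ltn_sorted].
  by move=> i; rewrite mem_filter => /andP[/asboolP].
have es0 x : 0%N \notin es x by apply/mapP => -[].
have esn x i : (nth 0%N (es x) i < n.+1)%N.
  case: (ltnP i (size (es x))) => [i_s|si]; last by rewrite nth_default.
  have /mapP[j] := mem_nth 0%N i_s; rewrite mem_filter mem_iota /= add0n => /andP[_ jn] ->.
  by rewrite ltnS.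
pose code x : 'I_K.+1 * {ffun 'I_L -> 'I_n.+1} * {ffun 'I_L -> 'I_K.+1} :=
  (c x, [ffun i : 'I_L => Ordinal (esn x i)],
   [ffun i : 'I_L => c (iter (nth 0%N (es x) i) g x)]).
have code_inj : {in S &, injective code}.
  move=> x y xS yS [cxy exy c'xy]; apply: contrapT => xNy.
  have x01 : 0 <= x <= 1 by have := S01 x xS; rewrite /unitI /= in_itv.
  have y01 : 0 <= y <= 1 by have := S01 y yS; rewrite /unitI /= in_itv.
  have orb01 z j : 0 <= z <= 1 -> 0 <= iter j g z <= 1 by case: j => [//|j] _; rewrite iterS.
  have {}exy : es x = es y.
    apply: (@eq_nth_padded _ _ L) => // i iL.
    by move/ffunP/(_ (Ordinal iL)): exy; rewrite !ffunE => /(congr1 val).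
  have := Ssep x y xS yS xNy; apply/negP; rewrite -leNgt; apply: bowen_le; first by lra.
  move=> i i_n.
  have ex0 : exists s, (s \in 0%N :: es x) && (s <= i)%N by exists 0%N; rewrite mem_head.
  have bd s : (s \in 0%N :: es x) && (s <= i)%N -> (s <= i)%N by move=> /andP[].
  (* [s] is 0 or the instant after the latest exit; no exit occurs from [s] to [i]. *)
  case: (ex_maxnP ex0 bd) => s /andP[s_es si] smax.
  have noex z : es z = es x -> no_exit g e t (i - s) (iter s g z).
    move=> zx j ji; rewrite -iterD => E.
    have : (j + s).+1 \in es x.
      rewrite -zx; apply/map_f; rewrite mem_filter mem_iota /=; apply/andP; split.
        exact/asboolP.
      by lia.
    move=> js; have := smax (j + s).+1; rewrite inE js orbT /=.
    by move=> /(_ _)/implyP; lia.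
  rewrite -(subnK si) !iterD; apply: cP; [exact: orb01|exact: orb01| |exact: noex|exact: noex].
  move: s_es; rewrite inE => /predU1P[->//|/(nthP 0%N)[j jes <-]].
  have jL : (j < L)%N by exact: leq_trans (esL x).
  by move/ffunP/(_ (Ordinal jL)): c'xy; rewrite !ffunE /= exy.
have <- : #|{: 'I_K.+1 * {ffun 'I_L -> 'I_n.+1} * {ffun 'I_L -> 'I_K.+1}}| =
    (K.+1 * K.+1 ^ L * n.+1 ^ L)%N.
  by rewrite !card_prod !card_ffun !card_ord mulnAC.
have /card_uniqP : uniq (map code (enum_fset S)) by rewrite map_inj_in_uniq ?fset_uniq.
by rewrite size_map => <-; exact: max_card.
Qed.

Lemma uniform_iter f e m : continuous f -> 0 < e -> exists2 d, 0 < d &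
  forall x y, 0 <= x <= 1 -> 0 <= y <= 1 -> `|x - y| <= d ->
    forall i, (i <= m)%N -> `|iter i f x - iter i f y| <= e.
Proof.
move=> fc e0.
have e20 : 0 < e / 2 by rewrite divr_gt0.
have H z : exists r, 0 < r /\ forall y i, (i <= m)%N -> z - r < y < z + r ->
    iter i f z - e / 2 < iter i f y < iter i f z + e / 2.
  by have [r r0 Hr] := iter_delta z m fc e20; exists r.
have [r rP] := choice H.
have := @segment_compact R 0 1; rewrite compact_cover.
(* Half radii, so that a point [d]-close to [x] is still in the full neighbourhood. *)
move=> /(_ _ setT (fun z => `](z - r z / 2), (z + r z / 2)[%classic)).
case; [by move=> z _; exact: interval_open| |].
  by move=> z z01; exists z => //=; rewrite in_itv /=; have [] := rP z; lra.
move=> D _ Dcov.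
have [||d d0 dP] := @common_scale _ _ (enum_fset D) (fun z d => d <= r z / 2).
- by move=> z _; exists (r z / 2) => //; have [] := rP z; lra.
- by move=> z t t' _ t't ?; lra.
exists d => // x y x01 y01 xy i im; have [|z /= zD] := Dcov x; first by rewrite /= in_itv.
rewrite in_itv /= => xz; have [r0 Hr] := rP z; have dz := dP z zD.
move: xy; rewrite !ler_norml => xy.
have := Hr x i im; have := Hr y i im; lra.
Qed.

(** Time [i] of [f] is [i %/ m] steps of the persistent iterate followed by fewer than [m] steps of
    [f]. Sets separated for [f] are therefore separated for the iterate at a smaller scale. *)
Lemma sep_count f L e : continuous f -> unit_valued f ->
  (forall l, chain f l -> (l <= L)%N) -> 0 < e ->
  exists C, forall n (S : {fset R}), [set` S] `<=` unitI ->
    bowen_separated n e f [set` S] -> (#|` S| <= C * n.+1 ^ L)%N.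
Proof.
move=> fc f01 HL e0; have [m m0 [gp gp']] := persistent_of_bounded fc f01 HL.
have [d d0 Hd] := uniform_iter m fc e0.
have [||||C HC] := @sep_count_persistent (iter m f) L (d / 4) _ _ gp gp'.
- exact: continuous_iter.
- by move=> x; exact: unit_valued_iter.
- by move=> l /(chain_iter m0); exact: HL.
- by rewrite divr_gt0.
exists C => n S S01 Ssep; apply: HC => // x y xS yS xNy; rewrite ltNge; apply/negP.
have {1}-> : 4 * (d / 4) = d by field.
move=> dn; have := Ssep x y xS yS xNy; apply/negP; rewrite -leNgt.
apply: bowen_le => [|i i_n]; first exact: ltW.
have orb01 z j : z \in S -> 0 <= iter j (iter m f) z <= 1.
  move=> /S01; rewrite /unitI /= in_itv /= => z01; case: j => [//|j].
  by rewrite iterS; exact: unit_valued_iter.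
rewrite (divn_eq i m) addnC !iterD !iterM; apply: Hd; [exact: orb01|exact: orb01| |].
  apply: le_trans dn; apply: bowen_ge; exact: leq_ltn_trans (leq_div _ _) i_n.
by rewrite ltnW// ltn_mod.
Qed.

End Counting.

(** * Separated sets from one-way horseshoes *)

Section LowerBound.
Context {R : realType}.
Implicit Types (f g : R -> R) (A : nat -> set R) (e w x y : R) (m n k l d : nat) (s : seq nat).

Lemma compact_disjoint_dist (A B : set R) : compact A -> compact B -> A `&` B = set0 ->
  exists2 e, 0 < e & forall a b, A a -> B b -> e <= `|a - b|.
Proof.
move=> Ac Bc AB; have [|||e e0 H] := @pos_min_compact _ _ (fun ab : R * R => `|ab.1 - ab.2|) (A `*` B).
- by move=> ab; apply: cvg_norm; apply: cvgB; [exact: cvg_fst|exact: cvg_snd].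
- exact: compact_setX.
- move=> [a b] /= [Aa Bb]; rewrite normr_gt0 subr_eq0; apply/eqP => /= ab.
  have : (A `&` B) a by split; rewrite // ab.
  by rewrite AB.
- by exists e => // a b Aa Bb; exact: (H (a, b)).
Qed.

(* [itin i s y]: the orbit of [y] spends the times [0..s_0] in [A i], then the
   next [s_1 + 1] times in [A i.+1], and so on, ending exactly at [x]. *)
Fixpoint itin g A x i s y : Prop :=
  if s is d :: s' then
    (forall j, (j <= d)%N -> A i (iter j g y)) /\
    (if s' is [::] then iter d g y = x else itin g A x i.+1 s' (iter d.+1 g y))
  else False.

(** The orbit is built backwards from [x], pulling back inside [A j] by self-covering and passing
    from [A i.+1] to [A i] between blocks. *)
Lemma itin_exists g l A x s i : one_way_horseshoe g l A -> A l x -> (0 < size s)%N ->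
  (0 < i)%N -> (i + size s)%N = l.+1 -> exists y, itin g A x i s y.
Proof.
move=> [l0 _ _ _ cv] Ax.
have back j w d : (0 < j <= l)%N -> A j w ->
    exists2 y, (forall k, (k <= d)%N -> A j (iter k g y)) & iter d g y = w.
  move=> /andP[j0 jl] Aw; elim: d => [|d [y yA yw]].
    by exists w => // k; rewrite leqn0 => /eqP ->.
  have [z Az zy] := cv j j j0 (leqnn _) jl y (yA 0%N (leq0n _)).
  exists z; last by rewrite iterSr zy.
  by case=> [//|k] kd; rewrite iterSr zy; exact: yA.
elim: s i => [//|d s IH] i _ i0 E.
case: s => [|d' s] in IH E *.
  have il : i = l by move: E => /=; lia.
  have [||y yA yx] := back i x d; [by rewrite il l0 leqnn|by rewrite il|].
  by exists y; split=> //; rewrite -il.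
have [|||y1 H1] := IH i.+1; rewrite ?addSnnS//.
have [|w Aw wy1] := cv i i.+1 i0 (leqnSn _) _ y1 (H1.1 0%N (leq0n _)).
  by move: E => /=; lia.
have [|y yA yw] := back i w d _ Aw; first by move: E => /=; lia.
by exists y; split=> //; rewrite iterS yw wy1.
Qed.

Lemma itin_head g A x i d s y : itin g A x i (d :: s) y -> A i y.
Proof. by move=> [H _]; exact: (H 0%N). Qed.

(** At the first differing waiting time, the shorter wait has led into the next set, which gives
    [e1]. In the last block, one orbit is at [x] while the other is at a strict iterate of [x],
    which gives [e0]. *)
Lemma itin_separated g l A x e0 e1 N s s' i y y' :
  (forall n, (0 < n)%N -> e0 <= `|iter n g x - x|) ->
  (forall i j a b, (1 <= i <= l)%N -> (1 <= j <= l)%N -> i <> j -> A i a -> A j b ->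
     e1 <= `|a - b|) ->
  size s = size s' -> (0 < i)%N -> (i + size s)%N = l.+1 -> s <> s' ->
  all (fun d => (d < N)%N) s -> all (fun d => (d < N)%N) s' ->
  itin g A x i s y -> itin g A x i s' y' ->
  exists2 j, (j < N * size s)%N & Num.min e0 e1 <= `|iter j g y - iter j g y'|.
Proof.
move=> He0 He1.
have lt_case d d' r r' j z z' : (d < d')%N -> (d' < N)%N -> size r = size r' -> (0 < j)%N ->
    (j + size (d :: r))%N = l.+1 -> itin g A x j (d :: r) z -> itin g A x j (d' :: r') z' ->
    exists2 k, (k < N * size (d :: r))%N & Num.min e0 e1 <= `|iter k g z - iter k g z'|.
  move=> dd' d'N rr' j0 E; case: r => [|c r] in rr' E *; case: r' => [//|c' r'] in rr' *; last 2 first.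
  - by [].
  - move=> [_ H] [H' _]; exists d.+1; first exact: leq_trans (leq_ltn_trans dd' d'N) (leq_pmulr _ _).
    rewrite ge_min; apply/orP; right.
    apply: (He1 j.+1 j); [by move: E => /=; lia|by move: E => /=; lia|lia|exact: itin_head H|].
    exact: H'.
  move=> [_ zx] [_ z'x]; exists d'; first by rewrite muln1.
  rewrite ge_min; apply/orP; left; rewrite z'x -(subnK (ltnW dd')) iterD zx.
  by apply: He0; rewrite subn_gt0.
elim: s s' i y y' => [|d s IH] [|d' s'] i y y' //= [ss'] i0 E neq /andP[dN sN] /andP[d'N s'N].
move=> I I'; have [dd'|dd'|dd'] := ltngtP d d'.
- exact: (lt_case d d' s s' i).
- have [|j jN Hj] := lt_case d' d s' s i y' y dd' dN (esym ss') i0 _ I' I; first by rewrite /= -ss'.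
  by exists j; rewrite ?ss'// distrC.
- case: s s' => [|c s] [|c' s'] // in IH ss' E neq sN s'N I I' *.
    by case: neq; rewrite dd'.
  move: I I' => [_ I] [_]; rewrite -dd' => I'.
  have neq' : c :: s <> c' :: s' by move=> ss; apply: neq; rewrite dd' ss.
  have E' : (i.+1 + size (c :: s))%N = l.+1 by move: E => /=; lia.
  have [j jN Hj] := IH (c' :: s') i.+1 _ _ ss' isT E' neq' sN s'N I I'.
  exists (j + d.+1)%N; last by rewrite !iterD.
  by rewrite mulnS addnC -addnS leq_add.
Qed.

Lemma not_recurrent_dist g x : ~ recurrent g x ->
  exists2 e, 0 < e & forall n, (0 < n)%N -> e <= `|iter n g x - x|.
Proof.
move=> nr; apply: contrapT => H; apply: nr => e e0; apply: contrapT => N; apply: H.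
exists e => // n n0; rewrite leNgt; apply/negP => ne; apply: N; by exists n.
Qed.

Lemma horseshoe_sep f m l A : (0 < m)%N -> one_way_horseshoe (iter m f) l A ->
  exists2 e, 0 < e & forall n, (((n %/ (l * m)) ^ l)%:R%:E <= sep n e f)%E.
Proof.
move=> m0 H; have [l0 Ac disj [x Ax nrx] cv] := H; pose g := iter m f.
have [e0 e00 He0] := not_recurrent_dist nrx.
have [||e1 e10 He1] := @common_scale _ _ [seq (i, j) | i <- iota 1 l, j <- iota 1 l]
   (fun ij t => ij.1 <> ij.2 -> forall a b, A ij.1 a -> A ij.2 b -> t <= `|a - b|).
- move=> [i j] /allpairsP[[i' j'] /= [+ + [-> ->]]]; rewrite !mem_iota !add1n => il jl.
  case: (eqVneq i' j') => [->|/eqP ij]; first by exists 1.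
  have [t t0 Ht] := compact_disjoint_dist (Ac _ il).2 (Ac _ jl).2 (disj _ _ il jl ij).
  by exists t.
- by move=> ij t t' _ t't K ne a b Aa Ab; apply: le_trans t't (K ne _ _ Aa Ab).
have min0 : 0 < Num.min e0 e1 by rewrite lt_min e00.
exists (Num.min e0 e1 / 2); first by rewrite divr_gt0.
(* An itinerary of [l] waits below [N] takes at most [N * l] steps of [f^m], hence at most [n] steps
   of [f]. *)
move=> n; set N := (n %/ (l * m))%N.
have pt (s : l.-tuple 'I_N) : exists y, itin g A x 1 (map val s) y.
  by apply: (itin_exists H Ax) => //; rewrite size_map size_tuple// add1n.
have [ys ysP] := choice pt.
have sepy (s s' : l.-tuple 'I_N) : s != s' -> Num.min e0 e1 / 2 < bowen_dist n f (ys s) (ys s').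
  move=> ss'.
  have He1' i j a b : (1 <= i <= l)%N -> (1 <= j <= l)%N -> i <> j -> A i a -> A j b ->
      e1 <= `|a - b|.
    move=> il jl ij; apply: (He1 (i, j)) => //.
    by apply: allpairs_f; rewrite mem_iota add1n.
  have szE : size (map val s) = size (map val s') by rewrite !size_map !size_tuple.
  have sz1 : (1 + size (map val s))%N = l.+1 by rewrite size_map size_tuple add1n.
  have neq : map val s <> map val s'.
    by move=> /(inj_map val_inj)/val_inj E; rewrite E eqxx in ss'.
  have lt_N (u : l.-tuple 'I_N) : all (fun d => (d < N)%N) (map val u).
    by apply/allP => d /mapP[i _ ->] /=; exact: ltn_ord.
  have [j jN Hj] := itin_separated (i := 1%N) He0 He1' szE isT sz1 neq (lt_N s) (lt_N s') (ysP s) (ysP s').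
  rewrite size_map size_tuple in jN.
  have jn : (j * m < n)%N.
    apply: (@leq_trans (N * l * m)); first by rewrite ltn_mul2r m0.
    by rewrite -mulnA leq_trunc_div.
  apply: lt_le_trans (bowen_ge f _ _ jn); rewrite !iterM; apply: lt_le_trans Hj.
  by rewrite ltr_pdivrMr// ltr_pMr// ltr1n.
have ys_inj : injective ys.
  move=> s s' E; apply/eqP/negPn/negP => /sepy; rewrite E ltNge; apply/negP; rewrite negbK.
  by apply: bowen_le => [|i _]; rewrite ?subrr ?normr0 divr_ge0// ltW.
pose S := seq_fset tt (map ys (enum {: l.-tuple 'I_N})).
have Sin y : y \in S -> exists s : l.-tuple 'I_N, y = ys s.
  by rewrite seq_fsetE => /mapP[s _ ->]; exists s.
apply: ereal_sup_ubound; exists S.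
  split.
    move=> y /= /Sin[s ->]; apply: (Ac 1%N _).1 => //.
    have := ysP s; case: (s : seq _) (size_tuple s) => [|d s'] /=; first by move: l0 => /[swap] <-.
    by move=> _; exact: itin_head.
  by move=> y y' /= /Sin[s ->] /Sin[s' ->] yy'; apply: sepy; apply: contra_notN yy' => /eqP ->.
have uys : uniq (map ys (enum {: l.-tuple 'I_N})).
  by rewrite (map_inj_uniq ys_inj); exact: enum_uniq.
by rewrite size_seq_fset undup_id// size_map -cardE card_tuple card_ord.
Qed.

End LowerBound.

(** * Polynomial entropy *)

Section PolynomialEntropyBounds.
Context {R : realType}.
Implicit Types (f g : R -> R) (A : nat -> set R) (e d x y : R) (m n k l L : nat).

Local Open Scope ereal_scope.

Lemma limn_esup_le_eventually (u : (\bar R)^nat) (c : \bar R) N :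
  (forall n, (N <= n)%N -> u n <= c) -> limn_esup u <= c.
Proof.
move=> H; apply: ge_ereal_inf.
exists (ereal_sup [set u n | n in [set n | (N <= n)%N]]).
  by exists [set n | (N <= n)%N] => //; exact: nbhs_infty_ge.
by apply: ge_ereal_sup => _ [n /= Nn <-]; exact: H.
Qed.

Lemma limn_esup_ge_eventually (u : (\bar R)^nat) (c : \bar R) N :
  (forall n, (N <= n)%N -> c <= u n) -> c <= limn_esup u.
Proof.
move=> H; apply: le_ereal_inf_tmp => _ [B [M _ MB] <-].
apply: (@le_trans _ _ (u (maxn N M))); first by apply: H; exact: leq_maxl.
by apply: ereal_sup_ubound; exists (maxn N M) => //; apply: MB; exact: leq_maxr.
Qed.

Lemma le_limn_esup (u v : (\bar R)^nat) : (forall n, u n <= v n) -> limn_esup u <= limn_esup v.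
Proof.
move=> H; apply: le_ereal_inf_tmp => _ [B BF <-]; apply: ge_ereal_inf.
exists (ereal_sup [set u n | n in B]); first by exists B.
apply: ge_ereal_sup => _ [n Bn <-]; apply: le_trans (H n) _.
by apply: ereal_sup_ubound; exists n.
Qed.

Lemma sep_ge1 n e f : 1 <= sep n e f.
Proof.
apply: ereal_sup_ubound; exists [fset (0%R : R)]%fset; last by rewrite cardfs1.
split=> [x /=|x y /=]; rewrite !inE.
  by move=> /eqP ->; rewrite /unitI /= in_itv /= lexx ler01.
by move=> /eqP -> /eqP ->.
Qed.

Lemma sep_anti n e d f : (e <= d)%R -> sep n d f <= sep n e f.
Proof.
move=> ed; apply: ge_ereal_sup => _ [S [S01 Ssep] <-]; apply: ereal_sup_ubound.
exists S => //; split=> // x y Sx Sy xy; apply: le_lt_trans ed _; exact: Ssep.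
Qed.

Lemma ln_nat_ge0 n : (0 <= ln (n%:R : R))%R.
Proof. by case: n => [|n]; [rewrite ln0|apply: ln_ge0; rewrite ler1n]. Qed.

Lemma ln_nat_gt0 n : (1 < n)%N -> (0 < ln (n%:R : R))%R.
Proof. by move=> n1; apply: ln_gt0; rewrite ltr1n. Qed.

Definition growth e f := limn_esup (fun n => lne (sep n e f) / (ln n%:R)%:E).

Lemma growth_anti e d f : (e <= d)%R -> growth d f <= growth e f.
Proof.
move=> ed; apply: le_limn_esup => n; apply: lee_wpmul2r.
  by rewrite inve_ge0 lee_fin ln_nat_ge0.
have s1 c : sep n c f \in `[0, +oo].
  by rewrite in_itv /= leey andbT; apply: le_trans (sep_ge1 n c f); rewrite lee01.
by rewrite lee_lne ?s1// sep_anti.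
Qed.

(** The growth rate is monotone in the scale, so its limit at [0^+] is a supremum. *)
Lemma hpolE f : hpol f = ereal_sup [set growth e f | e in `]0%R, 1%R[].
Proof.
apply: cvg_lim => //; apply: nonincreasing_at_right_cvge => [|e d _ _ ed].
  by rewrite bnd_simp.
exact: growth_anti.
Qed.

Lemma hpol_ge_growth e f : (0 < e)%R -> growth e f <= hpol f.
Proof.
move=> e0; rewrite hpolE; apply: (@le_trans _ _ (growth (Num.min e (1 / 2)%R) f)).
  by apply: growth_anti; rewrite ge_min lexx.
apply: ereal_sup_ubound; exists (Num.min e (1 / 2)%R) => //=.
rewrite in_itv /= lt_min e0 gt_min; apply/andP; split; first by lra.
by apply/orP; right; lra.
Qed.

Lemma hpol_le_growth f (c : \bar R) : (forall e, (0 < e)%R -> growth e f <= c) -> hpol f <= c.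
Proof.
move=> H; rewrite hpolE; apply: ge_ereal_sup => _ [e /= e01 <-]; apply: H.
by move: e01; rewrite in_itv => /andP[].
Qed.

Lemma ln_ratio_small (K d : R) : (0 < d)%R ->
  exists N, forall n, (N <= n)%N -> (1 < n)%N /\ (K <= d * ln n%:R)%R.
Proof.
move=> d0; exists (maxn 2 (Num.bound (expR (K / d)))) => n.
rewrite geq_max => /andP[n1 n2]; split=> //.
rewrite mulrC -ler_pdivrMr// -[leLHS]expRK ler_ln ?posrE ?expR_gt0 ?ltr0n ?(ltnW n1)//.
apply: le_trans (ltW (archi_boundP _)) _; first exact: expR_ge0.
by rewrite ler_nat.
Qed.

Lemma growth_le_poly e f L : (exists C, forall n (S : {fset R}), [set` S] `<=` unitI ->
    bowen_separated n e f [set` S] -> (#|` S| <= C * n.+1 ^ L)%N) ->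
  growth e f <= L%:R%:E.
Proof.
move=> [C HC]; apply/lee_addgt0Pr => d d0.
have [N HN] := ln_ratio_small (ln (C.+1%:R) + ln 2 *+ L)%R d0.
apply: (@limn_esup_le_eventually _ _ N) => n /HN[n1 Kn].
have sepC : sep n e f <= (C.+1 * n.+1 ^ L)%:R%:E.
  apply: ge_ereal_sup => _ [S [S01 Ssep] <-]; rewrite lee_fin ler_nat.
  by apply: leq_trans (HC n S S01 Ssep) _; rewrite leq_mul.
have pos : (0 < (C.+1 * n.+1 ^ L)%:R :> R)%R by rewrite ltr0n muln_gt0 expn_gt0.
rewrite inver gt_eqF ?ln_nat_gt0// lee_pdivrMr ?ln_nat_gt0//.
apply: (@le_trans _ _ (lne (C.+1 * n.+1 ^ L)%:R%:E)).
  rewrite lee_lne//.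
    by rewrite in_itv /= leey andbT; apply: le_trans (sep_ge1 n e f); rewrite lee01.
  by rewrite in_itv /= leey andbT lee_fin ltW.
rewrite lne_EFin// -EFinD -EFinM lee_fin natrM natrX lnM ?posrE ?exprn_gt0 ?ltr0n// lnXn ?ltr0n//.
(* From [n.+1 <= 2 * n]; the factor 2 and the constant are absorbed by [d * ln n]. *)
have ln1 : (ln (n.+1%:R : R) <= ln 2 + ln n%:R)%R.
  rewrite -lnM ?posrE ?ltr0n ?(ltnW n1)// ler_ln ?posrE ?mulr_gt0 ?ltr0n ?(ltnW n1)//.
  by rewrite -natrM ler_nat; lia.
have : (ln (n.+1%:R : R) *+ L <= (ln 2 + ln n%:R) *+ L)%R by rewrite lerMn2r ln1 orbT.
rewrite mulrnDl -[(ln n%:R *+ L)%R]mulr_natl; lra.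
Qed.

Lemma growth_ge_poly e f l c : (0 < c)%N ->
  (forall n, ((n %/ c) ^ l)%:R%:E <= sep n e f) -> l%:R%:E <= growth e f.
Proof.
move=> c0 H; apply/lee_addgt0Pr => d d0.
have [N HN] := ln_ratio_small (ln (2 * c)%:R *+ l)%R d0.
rewrite -leeBlDr//.
apply: (@limn_esup_ge_eventually _ _ (maxn N (2 * c))) => n.
rewrite geq_max => /andP[/HN[n1 Kn] cn].
have q0 : (0 < n %/ c)%N by rewrite divn_gt0//; lia.
rewrite inver gt_eqF ?ln_nat_gt0// lee_pdivlMr ?ln_nat_gt0//.
apply: (@le_trans _ _ (lne ((n %/ c) ^ l)%:R%:E)); last first.
  rewrite lee_lne//.
    by rewrite in_itv /= leey andbT lee_fin.
  by rewrite in_itv /= leey andbT; apply: le_trans (sep_ge1 n e f); rewrite lee01.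
rewrite lne_EFin ?ltr0n ?expn_gt0 ?q0// -EFinB -EFinM lee_fin natrX lnXn ?ltr0n//.
(* From [n <= 2 * c * (n %/ c)], valid since [n >= c]. *)
have ln1 : (ln (n%:R : R) <= ln (2 * c)%:R + ln (n %/ c)%:R)%R.
  rewrite -lnM ?posrE ?ltr0n ?q0// ?ler_ln ?posrE ?mulr_gt0 ?ltr0n ?q0//; try lia.
  by rewrite -natrM ler_nat; have := divn_eq n c; have := ltn_mod n c; nia.
have : (ln (n%:R : R) *+ l <= (ln (2 * c)%:R + ln (n %/ c)%:R) *+ l)%R by rewrite lerMn2r ln1 orbT.
rewrite mulrnDl -[(ln n%:R *+ l)%R]mulr_natl; lra.
Qed.

Lemma hpol_ge_order f m l A : (0 < m)%N -> one_way_horseshoe (iter m f) l A ->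
  l%:R%:E <= hpol f.
Proof.
move=> m0 H; have [e e0 He] := horseshoe_sep m0 H; have [l0 _ _ _ _] := H.
by apply: le_trans (hpol_ge_growth f e0); apply: growth_ge_poly He; rewrite muln_gt0 l0.
Qed.

Lemma hpol_ge0 f : 0 <= hpol f.
Proof.
apply: le_trans (hpol_ge_growth f ltr01).
by apply: (@growth_ge_poly _ _ 0 1) => // n; rewrite expn0; exact: sep_ge1.
Qed.

Lemma hpol_le_order f L : continuous f -> unit_valued f ->
  (forall l, chain f l -> (l <= L)%N) -> hpol f <= L%:R%:E.
Proof.
move=> fc f01 HL; apply: hpol_le_growth => e e0; apply: growth_le_poly.
exact: sep_count.
Qed.

Lemma esup_or0_ge (B : set (\bar R)) (x : \bar R) : B x -> x <= esup_or0 B.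
Proof.
move=> Bx; rewrite /esup_or0; case: eqVneq => [B0|_]; last exact: ereal_sup_ubound.
by move: Bx; rewrite B0.
Qed.

Lemma esup_or0_le (B : set (\bar R)) (c : \bar R) : 0 <= c -> (forall z, B z -> z <= c) ->
  esup_or0 B <= c.
Proof.
by move=> c0 H; rewrite /esup_or0; case: eqVneq => // _; exact: ge_ereal_sup.
Qed.

Lemma interval_orders_sub f : interval_horseshoe_orders f `<=` horseshoe_orders f.
Proof. by move=> _ [l [n [A [n0 H _]]] <-]; exists l => //; exists n, A. Qed.

Lemma esup_or0_ge0 f : 0 <= esup_or0 (interval_horseshoe_orders f).
Proof.
rewrite /esup_or0; case: eqVneq => // /set0P[x Bx].
by apply: le_trans (ereal_sup_ubound Bx); case: Bx => l _ <-; rewrite lee_fin.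
Qed.

(** The value [v] is the least bound on the orders of chains, or [+oo]. It closes the cycle from
    interval horseshoes to arbitrary ones, to the entropy, and back. *)
Lemma horseshoe_entropy f : continuous f -> unit_valued f -> exists v : \bar R,
  [/\ nat_or_infty v, hpol f = v, esup_or0 (horseshoe_orders f) = v &
      esup_or0 (interval_horseshoe_orders f) = v].
Proof.
move=> fc f01.
have cb : esup_or0 (interval_horseshoe_orders f) <= esup_or0 (horseshoe_orders f).
  apply: esup_or0_le => [|z /interval_orders_sub]; last exact: esup_or0_ge.
  rewrite /esup_or0; case: eqVneq => // /set0P[z Bz].
  by apply: le_trans (ereal_sup_ubound Bz); case: Bz => l _ <-; rewrite lee_fin.
have ba : esup_or0 (horseshoe_orders f) <= hpol f.
  apply: esup_or0_le => [|_ [l [n [A [n0 H]]] <-]]; first exact: hpol_ge0.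
  exact: hpol_ge_order n0 H.
suff [v [nv vc av]] : exists v : \bar R, [/\ nat_or_infty v,
    v <= esup_or0 (interval_horseshoe_orders f) & hpol f <= v].
  exists v; split=> //; apply: le_anti.
  - by rewrite av (le_trans vc)// (le_trans cb).
  - by rewrite (le_trans ba av) (le_trans vc cb).
  - by rewrite (le_trans cb (le_trans ba av)) vc.
case: (pselect (exists L, forall l, chain f l -> (l <= L)%N)) => [bd|unbd].
  pose P L := `[< forall l, chain f l -> (l <= L)%N >].
  have exP : exists L, P L by case: bd => L HL; exists L; apply/asboolP.
  case: (ex_minnP exP) => L /asboolP HL Lmin; exists L%:R%:E; split.
  - by right; exists L.
  (* By minimality a positive least bound is attained by a chain. *)
  - case: L => [|L] in HL Lmin *; first exact: esup_or0_ge0.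
    apply/esup_or0_ge/chain_orders => //; apply: contrapT => nch.
    have : P L.
      apply/asboolP => l cl; have := HL l cl; rewrite leq_eqVlt => /predU1P[lL|//].
      by rewrite lL in cl.
    by move/Lmin; rewrite ltnn.
  - exact: hpol_le_order.
exists +oo; split; [by left| |exact: leey].
rewrite leye_eq; apply/eqP/eqyP => r r0.
apply: (@le_trans _ _ (Num.bound r)%:R%:E); first by rewrite lee_fin ltW// archi_boundP// ltW.
have [l cl Ll] : exists2 l, chain f l & (Num.bound r < l)%N.
  apply: contrapT => H; apply: unbd; exists (Num.bound r) => l cl.
  by rewrite leqNgt; apply/negP => Ll; apply: H; exists l.
apply: (@le_trans _ _ l%:R%:E); first by rewrite lee_fin ler_nat ltnW.
by apply/esup_or0_ge/chain_orders => //; exact: leq_ltn_trans Ll.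
Qed.

End PolynomialEntropyBounds.

(** * Clamping to the unit interval *)

Section Clamp.
Context {R : realType}.
Implicit Types (f g : R -> R) (x y : R).

(** The nearest-point retraction of the line onto [0,1], written with absolute values so that
    continuity is immediate. *)
Definition clamp x : R := (`|x| - `|x - 1| + 1) / 2.

Lemma clamp_id x : 0 <= x <= 1 -> clamp x = x.
Proof.
move=> /andP[x0 x1]; rewrite /clamp ger0_norm// ler0_norm; last lra.
by field.
Qed.

Lemma clamp_unit x : 0 <= clamp x <= 1.
Proof.
rewrite /clamp; have [x0|x0] := leP 0 x.
  by rewrite (ger0_norm x0); case: (leP 0 (x - 1)) => x1; [rewrite ger0_norm//|rewrite ltr0_norm//]; lra.
by rewrite ltr0_norm// ltr0_norm; lra.
Qed.

Lemma continuous_clamp : continuous clamp.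
Proof.
move=> x; apply: cvgMr_tmp; apply: cvgD; last exact: cvg_cst.
apply: cvgB; first by apply: cvg_norm; exact: cvg_id.
by apply: cvg_norm; apply: cvgB; [exact: cvg_id|exact: cvg_cst].
Qed.

Lemma continuous_extension f : {within `[0, 1], continuous f} -> continuous (f \o clamp).
Proof.
move=> /subspace_continuousP fc x.
have clA y : `[0, 1]%classic (clamp y) by rewrite /= in_itv /= clamp_unit.
apply: (@cvg_comp _ _ _ clamp f _ (within `[0, 1]%classic (nbhs (clamp x)))); last exact: fc.
move=> P PA; have H := @continuous_clamp x _ PA.
by apply: (@filterS _ (nbhs x) _ _ _ _ H) => y /(_ (clA y)).
Qed.

Lemma iter_extension f n x : (forall y, 0 <= y <= 1 -> 0 <= f y <= 1) -> 0 <= x <= 1 ->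
  iter n (f \o clamp) x = iter n f x /\ 0 <= iter n f x <= 1.
Proof.
move=> f01 x01; elim: n => [//|n [IH1 IH2]].
by rewrite !iterS IH1 /= clamp_id//; split=> //; exact: f01.
Qed.

Definition same_orbits f g := forall n x, 0 <= x <= 1 -> iter n f x = iter n g x.

Lemma same_orbits_sym f g : same_orbits f g -> same_orbits g f.
Proof. by move=> H n x x01; rewrite H. Qed.

Lemma same_orbits_horseshoe f g m l A : same_orbits f g ->
  one_way_horseshoe (iter m f) l A -> one_way_horseshoe (iter m g) l A.
Proof.
move=> fg [l0 Ac disj [x Ax nx] cv].
have A01 i y : (1 <= i <= l)%N -> A i y -> 0 <= y <= 1.
  by move=> il Ay; have := (Ac i il).1 y Ay; rewrite /unitI /= in_itv.
split=> //.
  exists x => // rx; apply: nx => e /rx[k k0 H]; exists k => //; move: H.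
  by rewrite -!iterM fg//; apply: A01 Ax; rewrite l0 leqnn.
move=> i j i1 ij jl y /(cv i j i1 ij jl)[z Az zy]; exists z => //.
by rewrite -fg//; apply: (A01 i) => //; rewrite i1 (leq_trans ij).
Qed.

Lemma same_orbits_orders f g : same_orbits f g -> horseshoe_orders f = horseshoe_orders g.
Proof.
have half f' g' : same_orbits f' g' -> horseshoe_orders f' `<=` horseshoe_orders g'.
  move=> fg _ [l [n [A [n0 H]]] <-]; exists l => //; exists n, A; split=> //.
  exact: same_orbits_horseshoe H.
by move=> fg; apply/seteqP; split; apply: half => //; exact: same_orbits_sym.
Qed.

Lemma same_orbits_interval_orders f g : same_orbits f g ->
  interval_horseshoe_orders f = interval_horseshoe_orders g.
Proof.
have half f' g' : same_orbits f' g' ->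
    interval_horseshoe_orders f' `<=` interval_horseshoe_orders g'.
  move=> fg _ [l [n [A [n0 H1 H2]]] <-]; exists l => //; exists n, A; split=> //.
  exact: same_orbits_horseshoe H1.
by move=> fg; apply/seteqP; split; apply: half => //; exact: same_orbits_sym.
Qed.

Lemma same_orbits_hpol f g : same_orbits f g -> hpol f = hpol g.
Proof.
have half f' g' n e : same_orbits f' g' -> (sep n e f' <= sep n e g')%E.
  move=> fg; apply: ge_ereal_sup => _ [S [S01 Ssep] <-]; apply: ereal_sup_ubound.
  exists S => //; split=> // x y Sx Sy xy; have := Ssep x y Sx Sy xy.
  have x01 : 0 <= x <= 1 by have := S01 x Sx; rewrite /unitI /= in_itv.
  have y01 : 0 <= y <= 1 by have := S01 y Sy; rewrite /unitI /= in_itv.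
  by rewrite /bowen_dist; under eq_bigr do rewrite !fg//.
move=> fg; rewrite !hpolE; congr ereal_sup; congr (image _ _); apply/funext => e.
congr limn_esup; apply/funext => n; congr (lne _ / _)%E.
by apply: le_anti; rewrite !half//; exact: same_orbits_sym.
Qed.

End Clamp.

Theorem theorem26 (R : realType) (f : R -> R)
    (fcont : {within `[0, 1], continuous f})
    (fmaps : forall x : R, x \in `[0, 1] -> f x \in `[0, 1]) :
  [/\ hpol f = esup_or0 (horseshoe_orders f),
      esup_or0 (horseshoe_orders f) = esup_or0 (interval_horseshoe_orders f),
      [/\ nat_or_infty (hpol f), nat_or_infty (esup_or0 (horseshoe_orders f)) &
          nat_or_infty (esup_or0 (interval_horseshoe_orders f))] &
      hpol f \is a fin_num -> exists m : int, hpol f = m%:~R%:E].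
Proof.
have f01 y : 0 <= y <= 1 -> 0 <= f y <= 1.
  by move=> y01; have := fmaps y; rewrite !in_itv /=; apply.
(* Replacing [f] by [f \o clamp] gives a continuous map of the whole line with values in [0,1] and
   leaves all three quantities unchanged. *)
have fF : same_orbits f (f \o clamp).
  by move=> n x x01; have [-> _] := iter_extension n f01 x01.
rewrite (same_orbits_hpol fF) (same_orbits_orders fF) (same_orbits_interval_orders fF).
have [|v [nv -> -> ->]] := horseshoe_entropy (continuous_extension fcont).
  by move=> x; apply: f01; exact: clamp_unit.
split=> //; case: nv => [->//|[k ->] _].
by exists k%:Z; rewrite pmulrn.
Qed.
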